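(* Let $\alpha,\beta,\delta\in\mathbb{R}$ with $\beta\neq0$ and $\Delta:=\delta-\alpha-2\beta+\beta^2+\alpha\delta=0$. Let $\mathcal{K}_G$ be the Green's operator of the general self-adjoint real-coupled (GSARC) problem with boundary conditions $u'(0)=\alpha u(0)+\beta u(1)$, $u'(1)=-\beta u(0)+\delta u(1)$ on $[0,1]$. Then $\mathcal{K}_G$ is an up-to-rank-$4$ perturbation of $\mathcal{K}$, i.e. $\mathcal{T}=\mathcal{K}-\mathcal{K}_G$ has rank at most $4$. Moreover, $$\mathcal{T}f(x)=\sum_{k=1}^{\operatorname{rank}(\mathcal{T})}\langle f,u_k\rangle\,u_k(x),$$ where the $u_k$ are the eigenvectors of the matrix $M_{\mathcal{T}}$ of $\mathcal{T}$.
   Context: $\langle f,g\rangle=\int_0^1f(x)g(x)\,dx$. $\mathcal{K}$ is the integral operator on $L^2(0,1)$ given by $\mathcal{K}f(x)=-\frac12\int_0^1|x-y|\,f(y)\,dy$. $A$ denotes the self-adjoint operator $-\frac{d^2}{dx^2}$ on $L^2(0,1)$ with the stated boundary conditions; it has discrete spectrum. $P$ denotes the Riesz (orthogonal) projection onto $\ker A$. The Green's operator $\mathcal{K}_G$ is the bounded operator $S$ on $L^2(0,1)$ determined by $AS=I-P$ and $SP=PS=0$; equivalently $S=\frac{1}{2\pi i}\oint z^{-1}(A-zI)^{-1}\,dz$ over a small positively oriented circle around $0$ enclosing no nonzero eigenvalue of $A$. It is an integral operator, $\mathcal{K}_Gf(x)=\int_0^1G_0(x,y)f(y)\,dy$,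 with $G_0$ the Green's function. The kernel of $\mathcal{T}$ is a symmetric polynomial in $x,y$ of degree at most $3$ in each variable, so the eigenfunctions of $\mathcal{T}$ are sought in the form $f(x)=a_0+a_1x+a_2x^2+a_3x^3$. $M_{\mathcal{T}}$ is the $4\times4$ matrix describing the action of $\mathcal{T}$ on the coefficients $(a_0,a_1,a_2,a_3)$, and its eigenvectors are identified with the corresponding polynomials $u_k(x)$. *)

(* Defs.v *)
From HB Require Import structures.
From mathcomp Require Import all_boot all_order all_algebra.
From mathcomp Require Import all_classical all_reals all_analysis.
From mathcomp Require Import complex.
Set Implicit Arguments.
Unset Strict Implicit.
Unset Printing Implicit Defensive.
Import Order.TTheory GRing.Theory Num.Theory.
Local Open Scope classical_set_scope.
Local Open Scope ring_scope.
Local Open Scope complex_scope.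

(* The space is the complex L^2(0,1). Its elements
   are represented by functions R -> R[i], of which only the values on [0,1]
   matter, up to equality almost everywhere (eqL2). *)

Section L2.
Context {R : realType}.
Local Notation mu := (@lebesgue_measure R).
Local Notation I01 := (`[0, 1]%classic : set R).
Implicit Types f g : R -> R[i].

Definition eqL2 f g : Prop := ae_eq mu I01 f g.

(* MathComp-Analysis integrates real-valued functions only, so a complex
   integral is taken componentwise. *)
Definition cintegral (D : set R) f : R[i] :=
  Rintegral mu D (fun x => complex.Re (f x)) +i*
  Rintegral mu D (fun x => complex.Im (f x)).

Definition L2 f : Prop :=
  [/\ measurable_fun I01 (fun x => complex.Re (f x)),
      measurable_fun I01 (fun x => complex.Im (f x)) &
      mu.-integrable I01 (fun x => (complex.Re `|f x| ^+ 2)%:E)].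

Definition L2norm f : R :=
  Num.sqrt (Rintegral mu I01 (fun x => complex.Re `|f x| ^+ 2)).

(* The bilinear pairing <f,g>: there is no conjugation. *)
Definition pairing f g : R[i] := cintegral I01 (fun x => f x * g x).

(* The Hilbert space inner product of L^2(0,1). *)
Definition L2inner f g : R[i] := cintegral I01 (fun x => f x * (g x)^*).

Definition operator : Type := (R -> R[i]) -> (R -> R[i]).

(* The first two conditions say that S acts on classes. *)
Definition bounded_operator (S : operator) : Prop :=
  [/\ forall f, L2 f -> L2 (S f),
      forall f g, L2 f -> L2 g -> eqL2 f g -> eqL2 (S f) (S g),
      forall (a : R[i]) f g, L2 f -> L2 g ->
        eqL2 (S (fun x => a * f x + g x)) (fun x => a * S f x + S g x) &
      exists B : R, forall f, L2 f -> L2norm (S f) <= B * L2norm f].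

(* The range of T, as a subspace of L^2(0,1), has a basis g_0, ..., g_(r-1). *)
Definition has_rank (T : operator) (r : nat) : Prop :=
  exists g : 'I_r -> R -> R[i],
    [/\ forall k, L2 (g k),
        forall c : 'I_r -> R[i],
          eqL2 (fun x => \sum_(k < r) c k * g k x) (fun=> 0) ->
          forall k, c k = 0 &
        forall h, L2 h ->
          (exists2 f, L2 f & eqL2 (T f) h) <->
          (exists c : 'I_r -> R[i], eqL2 h (fun x => \sum_(k < r) c k * g k x))].

Definition opK : operator := fun f x =>
  - 2^-1 * cintegral I01 (fun y => `|x - y|%:C * f y).

(* F is absolutely continuous on [0,1] with almost everywhere derivative f. *)
Definition is_primitive (F f : R -> R[i]) : Prop :=
  [/\ mu.-integrable I01 (fun x => (complex.Re (f x))%:E),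
      mu.-integrable I01 (fun x => (complex.Im (f x))%:E) &
      forall x : R, 0 <= x <= 1 -> F x = F 0 + cintegral `[0, x] f].

(* The graph of A = -d^2/dx^2: u is in the domain of A and A u = w. The class
   of u has a representative u0 in H^2(0,1), i.e. u0 and du = u0' are absolutely
   continuous and u0'' = - w is in L^2, and the boundary conditions are imposed
   on this representative. *)
Definition gsarc (alpha beta delta : R) (u w : R -> R[i]) : Prop :=
  [/\ L2 u, L2 w &
    exists u0 du : R -> R[i],
      [/\ eqL2 u u0,
          is_primitive u0 du,
          is_primitive du (fun x => - w x),
          du 0 = alpha%:C * u0 0 + beta%:C * u0 1 &
          du 1 = - beta%:C * u0 0 + delta%:C * u0 1]].

(* An operator A is given by its graph: A u w means A u = w. *)
Definition in_kernel (A : (R -> R[i]) -> (R -> R[i]) -> Prop) u : Prop :=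
  A u (fun=> 0).

Definition orthogonal_projection_onto (V : (R -> R[i]) -> Prop)
    (P : operator) : Prop :=
  forall f, L2 f ->
    [/\ L2 (P f), V (P f) &
        forall h, V h -> L2inner (fun x => f x - P f x) h = 0].

(* S is the Green's operator: A S = I - P and S P = P S = 0. In particular S
   maps L^2(0,1) into the domain of A. *)
Definition is_green_operator (A : (R -> R[i]) -> (R -> R[i]) -> Prop)
    (P S : operator) : Prop :=
  bounded_operator S /\
  forall f, L2 f ->
    [/\ A (S f) (fun x => f x - P f x),
        eqL2 (S (P f)) (fun=> 0) &
        eqL2 (P (S f)) (fun=> 0)].

(* The polynomial function a_0 + a_1 x + a_2 x^2 + a_3 x^3. *)
Definition cubic (a : 'cV[R[i]]_4) (x : R) : R[i] :=
  \sum_(i < 4) a i 0 * x%:C ^+ i.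

Definition is_coef_matrix (T : operator) (M : 'M[R[i]]_4) : Prop :=
  forall a : 'cV[R[i]]_4, eqL2 (T (cubic a)) (cubic (M *m a)).

End L2.

(* Main.v *)
Require Import Defs.
From mathcomp Require Import all_boot all_order all_algebra.
From mathcomp Require Import all_classical all_reals all_analysis.
From mathcomp Require Import complex.
From mathcomp Require Import measurable_realfun ring lra.
Import Order.TTheory GRing.Theory Num.Theory.
Import numFieldNormedType.Exports.
Local Open Scope ring_scope.

(** Write K for the operator opK and S for the Green's operator KG, and let
T = K - S. Since (K f)'' = - f and (S f)'' = - f + P f, with P f affine, the
function T f has an affine second derivative: it is a polynomial of degree at
most 3 (opKB_KG_polynomial). So T maps into a space of dimension 4.

The bilinear pairing turns T into a symmetric operator. Both K and S solve
- u'' = w under boundary conditions for which the boundary term of Green's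
identity vanishes (green_identity, opK_symmetric, gsarc_symmetric); for S one
also uses that its range is orthogonal to the kernel of A, which is stable under
complex conjugation (KG_symmetric). Conjugation also shows that pairings of T
between real functions are real (KG_pairing_real).

Symmetry determines T everywhere from its values on cubic polynomials: the
moments of T f are the pairings of f with T x^j. Hence the coefficient vector of
T f is C m, where m is the vector of the first four moments of f and C is a real
symmetric matrix (coef_matrix_of_moments). On cubics the moments are given by the
Hilbert matrix H, so the matrix of T is M = C H.

Now C H is self-adjoint for the positive definite form H, and a spectral
theorem for such a pair (spectral_decomposition) writes C as a sum of terms
l_k e_k^T e_k with H-orthonormal real e_k and nonzero real l_k. Absorbing a
complex square root of l_k into e_k gives u_k with C = sum_k u_k u_k^T and
M u_k = l_k u_k, which is the expansion of T (finite_rank_expansion). A negative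
l_k makes u_k purely imaginary, which is why the expansion uses the pairing
without conjugation.

Integration by parts is needed for functions that are only absolutely continuous;
it is obtained from Fubini's theorem on a triangle (Rintegral_by_parts). *)

(** * Spectral decomposition relative to a positive definite form *)

Lemma trmx11 {R : pzRingType} (A : 'M[R]_1) : A^T = A.
Proof. by apply/matrixP => i j; rewrite mxE !ord1. Qed.

Section Spectral.
Context {R : rcfType} {n : nat}.
Variable H : 'M[R]_n.+1.
Hypothesis Hsym : H^T = H.
Hypothesis Hpos : forall v : 'rV[R]_n.+1, v != 0 -> 0 < (v *m H *m v^T) 0 0.
Local Open Scope complex_scope.

Local Notation q := (fun v : 'rV[R]_n.+1 => (v *m H *m v^T) 0 0).

Lemma gram_ge0 v : 0 <= q v.
Proof.
have [->|/Hpos/ltW//] := eqVneq v 0; by rewrite !mul0mx mxE.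
Qed.

Lemma gram_eq0 v : q v = 0 -> v = 0.
Proof.
by have [//|/Hpos] := eqVneq v 0; rewrite lt0r => /andP[/eqP].
Qed.

Lemma gramC (v w : 'rV[R]_n.+1) : v *m H *m w^T = w *m H *m v^T.
Proof.
by rewrite -[LHS]trmx11 !trmx_mul trmxK Hsym mulmxA.
Qed.

(** For G = H C one has q(v G^m) = v G^(2m) H v^T, so that G^(2m) = 0 forces
G^m = 0 by definiteness; halving repeatedly a power of two gives G = 0. *)
Lemma selfadjoint_nilpotent (C : 'M[R]_n.+1) k :
  C^T = C -> (H * C) ^+ k = 0 -> C = 0.
Proof.
move=> Csym; set G := H * C => Gk.
have G2 : forall m, G ^+ (m + m) = 0 -> G ^+ m = 0.
  move=> m Gm; apply/row_matrixP => i; rewrite row0 rowE; apply: gram_eq0.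
  set v := delta_mx _ _.
  have GH : forall j, (G ^+ j) *m H = H *m (G ^+ j)^T.
    elim=> [|j IH]; first by rewrite expr0 trmx1 mulmx1 mul1mx.
    rewrite exprSr -[_ * G]/(_ *m G) -mulmxA.
    have -> : G *m H = H *m G^T by rewrite trmx_mul Hsym Csym mulmxA.
    by rewrite mulmxA IH -mulmxA -trmx_mul -[G *m _]/(G * _) -exprS exprSr.
  rewrite /= trmx_mul -(mulmxA v) GH !mulmxA -(mulmxA v) -(mulmxA v).
  rewrite -(mulmxA H) -trmx_mul -[_ *m G ^+ m]/(_ * _) -exprD -GH Gm.
  by rewrite mul0mx mulmx0 mul0mx mxE.
have G2k : forall m, G ^+ (2 ^ m) = 0 -> G = 0.
  elim=> [|m IH]; first by rewrite expn0 expr1.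
  by rewrite expnS mul2n -addnn => /G2.
have G0 : G = 0.
  apply: (G2k k).
  by rewrite -(subnK (ltnW (ltn_expl k (isT : (1 < 2)%N)))) exprD Gk mulr0.
apply/row_matrixP => i; rewrite row0; apply: gram_eq0.
rewrite /= rowE trmx_mul Csym -mulmxA (mulmxA H) -[H *m C]/G G0.
by rewrite mul0mx mulmx0 mxE.
Qed.

Lemma map_Re_mulmx (v : 'rV[R[i]]_n.+1) (G : 'M[R]_n.+1) :
  map_mx (@complex.Re R) (v *m map_mx (real_complex R) G)
  = map_mx (@complex.Re R) v *m G.
Proof.
apply/rowP=> j; rewrite !mxE.
elim/big_rec2: _ => // k y1 y2 _ <-; rewrite !mxE.
by case: (v _ _) y2 => a b [c d] /=; rewrite mulr0 subr0.
Qed.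

Lemma map_Im_mulmx (v : 'rV[R[i]]_n.+1) (G : 'M[R]_n.+1) :
  map_mx (@complex.Im R) (v *m map_mx (real_complex R) G)
  = map_mx (@complex.Im R) v *m G.
Proof.
apply/rowP=> j; rewrite !mxE.
elim/big_rec2: _ => // k y1 y2 _ <-; rewrite !mxE.
by case: (v _ _) y2 => a b [c d] /=; rewrite mulr0 add0r.
Qed.

(** If 0 were the only eigenvalue, the characteristic polynomial would be a
power of X and A would be nilpotent by Cayley-Hamilton. *)
Lemma nonzero_eigenvalue (A : 'M[R[i]]_n.+1) :
  (forall k, A ^+ k != 0) -> exists2 z, z != 0 & eigenvalue A z.
Proof.
move=> An.
have [s charE] := closed_field_poly_normal (char_poly A).
have [/hasP[z zs z0]|/hasPn sz] := boolP (has (fun z => z != 0) s).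
  exists z => //; rewrite eigenvalue_root_char charE rootZ ?lead_coef_eq0.
    by rewrite root_prod_XsubC.
  by rewrite monic_neq0 // char_poly_monic.
have := Cayley_Hamilton A; rewrite charE (eqP (char_poly_monic A)) scale1r.
rewrite (eq_big_seq (fun=> 'X)) => [|z /sz/negPn/eqP->]; last by rewrite subr0.
rewrite big_const_seq count_predT -Monoid.iteropE -[iterop _ _ _ _]/('X ^+ _).
by rewrite rmorphXn /= horner_mx_X => /eqP; rewrite (negPf (An _)).
Qed.

(** A nonzero complex eigenvalue z of H C exists because H C is not nilpotent. For
an eigenvector a + i b, pairing the real and imaginary parts of the eigenvalue
equation gives Im z * (q a + q b) = 0, so z is real and a or b is a real
eigenvector. *)
Lemma selfadjoint_eigenvector (C : 'M[R]_n.+1) : C^T = C -> C != 0 ->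
  exists l (e : 'rV[R]_n.+1),
    [/\ l != 0, e *m H *m e^T = 1%:M & e *m H *m C = l *: e].
Proof.
move=> Csym C0; set G := H * C.
have [|z z0 /eigenvalueP[v vG v0]] := nonzero_eigenvalue (map_mx (real_complex R) G).
  move=> k; rewrite -rmorphXn map_mx_eq0; apply: contraNneq C0 => Gk.
  by apply/eqP/(selfadjoint_nilpotent _ k).
suff [l [e [l0 e0 eG]]] : exists l (e : 'rV[R]_n.+1),
    [/\ l != 0, e != 0 & e *m G = l *: e].
  have qe := Hpos e e0.
  exists l, ((Num.sqrt (q e))^-1 *: e); split => //.
    rewrite linearZ /= -!(scalemxAl, scalemxAr) scalerA -invfM -expr2.
    rewrite sqr_sqrtr ?ltW//; move: qe; set M := e *m H *m e^T => qe.
    by rewrite {2}[M]mx11_scalar scale_scalar_mx mulVf// gt_eqF.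
  have eHC : e *m H *m C = l *: e by rewrite -eG /G mulmxA.
  by rewrite -!scalemxAl eHC !scalerA mulrC.
pose a := map_mx (@complex.Re R) v; pose b := map_mx (@complex.Im R) v.
have aG : a *m G = complex.Re z *: a - complex.Im z *: b.
  rewrite -map_Re_mulmx vG; apply/rowP => j; rewrite !mxE.
  by case: (z) (v _ _) => [? ?] [? ?].
have bG : b *m G = complex.Re z *: b + complex.Im z *: a.
  rewrite -map_Im_mulmx vG; apply/rowP => j; rewrite !mxE.
  by case: (z) (v _ _) => [? ?] [? ?].
have v0' : (a != 0) || (b != 0).
  apply: contraNT v0; rewrite negb_or !negbK => /andP[/eqP a0 /eqP b0].
  apply/eqP/rowP => j; move/rowP: a0 => /(_ j); move/rowP: b0 => /(_ j).
  by rewrite !mxE; case: (v _ _) => ? ? /= -> ->.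
have z_re : complex.Im z = 0.
  have : a *m G *m H *m b^T = b *m G *m H *m a^T.
    by rewrite -[LHS]trmx11 !trmx_mul trmxK Hsym Csym /G !mulmxA.
  have cross (s t : R) (A B D : 'M[R]_1) :
      s *: D - t *: B = s *: D + t *: A -> t * (A 0 0 + B 0 0) = 0.
    by move=> /addrI/matrixP/(_ 0 0); rewrite !mxE mulrDr => <-; rewrite addNr.
  rewrite aG bG !(mulmxBl, mulmxDl) -!scalemxAl (gramC b a) => /cross/eqP.
  rewrite mulf_eq0 => /orP[/eqP//|]; rewrite paddr_eq0 ?gram_ge0//.
  move=> /andP[/eqP/gram_eq0 b0 /eqP/gram_eq0 a0].
  by move: v0'; rewrite a0 b0 eqxx.
have zr0 : complex.Re z != 0.
  by apply: contraNneq z0 => z1; case: (z) z1 z_re => ? ? /= -> ->.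
exists (complex.Re z); case/orP: v0' => ?; [exists a|exists b]; split => //.
  by rewrite aG z_re scale0r subr0.
by rewrite bG z_re scale0r addr0.
Qed.

(** Deflation: subtracting l e^T e for one normalised eigenvector lowers the rank
of C, because the new matrix is killed by e H while e stays in the old row
space. The remaining vectors lie in the row space of the new matrix, so they are
H-orthogonal to e. *)
Lemma spectral_decomposition m (C : 'M[R]_n.+1) : C^T = C -> (\rank C <= m)%N ->
  exists r (l : 'I_r -> R) (e : 'I_r -> 'rV[R]_n.+1),
    [/\ (r <= m)%N, forall k, l k != 0,
        forall j k, e j *m H *m (e k)^T = (j == k)%:R%:M &
        C = \sum_k l k *: ((e k)^T *m e k)].
Proof.
elim: m C => [|m IH] C Csym.
  rewrite leqn0 mxrank_eq0 => /eqP->.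
  exists 0, (fun=> 0), (fun=> 0); split=> //; try by case.
  by rewrite big_ord0.
move=> rC; have [C0|/selfadjoint_eigenvector] := eqVneq C 0.
  by have [|r [l [e [? ? ? ?]]]] := IH C Csym; [rewrite C0 mxrank0|
    exists r, l, e; split=> //; exact: leqW].
move=> /(_ Csym)[l0 [e0 [l0n e0H e0C]]].
pose C' := C - l0 *: (e0^T *m e0).
have C'sym : C'^T = C'.
  by rewrite /C' linearB linearZ /= trmx_mul trmxK Csym.
have eC' : e0 *m H *m C' = 0.
  by rewrite mulmxBr -scalemxAr mulmxA e0H mul1mx e0C subrr.
have e0S : (e0 <= C)%MS.
  by apply/submxP; exists (l0^-1 *: (e0 *m H));
    rewrite -scalemxAl e0C scalerA mulVf// scale1r.
have C'C : (C' <= C)%MS.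
  by rewrite addmx_sub// -scaleNr scalemx_sub// mulmx_sub.
have rC' : (\rank C' <= m)%N.
  rewrite -ltnS; apply: leq_trans rC; rewrite ltnNge; apply: contra l0n => rC.
  have CC' : (C <= C')%MS by rewrite -(geq_leqif (mxrank_leqif_sup C'C)).
  have /submxP[w ew] := submx_trans e0S CC'.
  have : e0 *m H *m e0^T = 0.
    by rewrite {2}ew trmx_mul C'sym mulmxA eC' mul0mx.
  by rewrite e0H => /matrixP/(_ 0 0); rewrite !mxE => /eqP; rewrite oner_eq0.
have [r [l [e [rm ln eH C'E]]]] := IH C' C'sym rC'.
have e0e : forall k, e0 *m H *m (e k)^T = 0.
  move=> k; have : e k *m H *m C' = l k *: e k.
    rewrite C'E mulmx_sumr (bigD1 k)//= -scalemxAr mulmxA eH eqxx mul1mx.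
    rewrite big1 ?addr0// => j jk.
    by rewrite -scalemxAr mulmxA eH eq_sym (negPf jk) mul_scalar_mx scale0r scaler0.
  move=> /(congr1 (fun w => (l k)^-1 *: w)); rewrite scalerA mulVf// scale1r => <-.
  by rewrite linearZ /= trmx_mul C'sym -scalemxAr mulmxA eC' mul0mx scaler0.
exists r.+1, (fun k => oapp l l0 (unlift ord0 k)),
  (fun k => oapp e e0 (unlift ord0 k)); split => //.
- by move=> k; case: unliftP => [j|] _ /=.
- move=> j k; case: (unliftP ord0 j) => [j' ->|->];
    case: (unliftP ord0 k) => [k' ->|->] /=; last 1 first.
  + by rewrite e0H.
  + by rewrite eH (inj_eq (@lift_inj _ _)).
  + by rewrite gramC e0e raddf0.
  + by rewrite e0e raddf0.
- rewrite big_ord_recl unlift_none /=.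
  under eq_bigr do rewrite liftK /=.
  by rewrite -C'E addrC subrK.
Qed.
End Spectral.

(** * Integration by parts for integrable functions *)

Section RealIntegration.
Local Open Scope classical_set_scope.
Context {R : realType}.
Local Notation mu := (@lebesgue_measure R).
Implicit Types (f g : R -> R).

Lemma integrable_tensor f g :
  mu.-integrable setT (EFin \o f) -> mu.-integrable setT (EFin \o g) ->
  (mu \x mu)%E.-integrable setT (fun p => (f p.1 * g p.2)%:E).
Proof.
move=> fi gi.
have mf : measurable_fun setT f by apply/measurable_EFinP; exact: measurable_int fi.
have mg : measurable_fun setT g by apply/measurable_EFinP; exact: measurable_int gi.
apply/integrable12ltyP => /=.
  by apply/measurable_EFinP/measurable_funM; apply: measurableT_comp.
have /integrableP[_ foo] := fi; have /integrableP[_ goo] := gi.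
under eq_integral => x _.
  under eq_integral do rewrite normrM EFinM.
  rewrite ge0_integralZl//; last by do 2 apply: measurableT_comp => //.
  over.
rewrite ge0_integralZr//; last 2 first.
- by do 2 apply: measurableT_comp => //.
- exact: integral_ge0.
by rewrite lte_mul_pinfty// ?integral_ge0// ge0_fin_numE ?integral_ge0.
Qed.

Lemma integrable_itv0S f (t x : R) : t <= x ->
  mu.-integrable `[0, x] (EFin \o f) -> mu.-integrable `[0, t] (EFin \o f).
Proof.
move=> tx; apply: integrableS => //.
by apply: subset_itvl; rewrite bnd_simp.
Qed.

Lemma Rintegral_itv0B f (s x : R) : 0 <= s <= x ->
  mu.-integrable `[0, x] (EFin \o f) ->
  \int[mu]_(t in `[s, x]) f t =
  \int[mu]_(t in `[0, x]) f t - \int[mu]_(t in `[0, s]) f t.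
Proof.
move=> /andP[s0 sx] fi; rewrite Rintegral_itvB ?bnd_simp// Rintegral_itv_obnd_cbnd//.
apply: integrableS fi => //.
by apply: subset_itvr; rewrite bnd_simp.
Qed.

(** The primitive of an integrable function is continuous on a compact interval. *)
Lemma measurable_primitive f (x : R) : 0 <= x ->
  mu.-integrable `[0, x] (EFin \o f) ->
  measurable_fun `[0, x] (fun t => \int[mu]_(s in `[0, t]) f s)
  /\ [bounded \int[mu]_(s in `[0, t]) f s | t in `[0, x]].
Proof.
move=> x0 fi; have cF := @parameterized_integral_continuous R 0 x f x0 fi.
split; first exact: subspace_continuous_measurable_fun.
have /compact_bounded[M [_ hM]] := continuous_compact cF (@segment_compact R 0 x).
by exists M; split; rewrite ?num_real// => y My t tx; apply: hM => //; exists t.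
Qed.

Lemma integrableM_primitive f g (x : R) : 0 <= x ->
  mu.-integrable `[0, x] (EFin \o f) -> mu.-integrable `[0, x] (EFin \o g) ->
  mu.-integrable `[0, x]
    (EFin \o (fun t : R => f t * \int[mu]_(s in `[0, t]) g s)).
Proof.
move=> x0 fi gi; have [mG bG] := measurable_primitive g x x0 gi.
set G := (fun t : R => \int[mu]_(s in `[0, t]) g s) in mG bG *.
rewrite (_ : _ \o _ = ((EFin \o f) \* (EFin \o G))%E); first exact: integrableMl.
by apply/funext => t /=; rewrite EFinM.
Qed.

(** Fubini applied to f(s) g(t) on the triangle s <= t: integrating first in s
gives g times the primitive of f, integrating first in t gives f times the
total integral of g minus its primitive. *)
Lemma Rintegral_by_parts f g (x : R) : 0 <= x ->
  mu.-integrable `[0, x] (EFin \o f) -> mu.-integrable `[0, x] (EFin \o g) ->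
  \int[mu]_(t in `[0, x])
    (f t * \int[mu]_(s in `[0, t]) g s + g t * \int[mu]_(s in `[0, t]) f s) =
  (\int[mu]_(t in `[0, x]) f t) * \int[mu]_(t in `[0, x]) g t.
Proof.
move=> x0 fi gi; pose D : set R := `[0, x].
have mD : measurable (D : set (measurableTypeR R)) by exact: measurable_itv.
pose h p := ((f \_ D) p.1 * (g \_ D) p.2 * (p.1 <= p.2)%R%:R).
pose F (t : R) := \int[mu]_(s in `[0, t]) f s.
pose G (t : R) := \int[mu]_(s in `[0, t]) g s.
have int0 : \int[mu]_(t in [set: R]) (0 : R) = 0.
  by rewrite /Rintegral integral0.
have inner_s t : \int[mu]_s h (s, t) = ((fun t => g t * F t) \_ D) t.
  rewrite /h /= [RHS]patchE; case: ifPn => tD; last first.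
    rewrite -[RHS]int0; apply: eq_Rintegral => s _.
    by rewrite [X in _ * X * _]patchE (negPf tD) mulr0 mul0r.
  have /andP[t0 tx] : 0 <= t <= x by move: tD; rewrite inE /D /= in_itv.
  have fti := integrable_itv0S _ _ _ tx fi.
  rewrite -RintegralZl// [RHS]Rintegral_mkcond; apply: eq_Rintegral => s _.
  rewrite !patchE tD !mem_setE /D !in_itv /=; case: (leP 0 s) => s0 /=.
    case: (leP s t) => [st|ts]; last by rewrite mulr0.
    by rewrite (le_trans st tx) mulr1 mulrC.
  by rewrite !mul0r.
have inner_t s : \int[mu]_t h (s, t) = ((fun s => f s * (G x - G s)) \_ D) s.
  rewrite /h /= [RHS]patchE; case: ifPn => sD; last first.
    rewrite -[RHS]int0; apply: eq_Rintegral => t _.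
    by rewrite [X in X * _ * _]patchE (negPf sD) !mul0r.
  have sx : 0 <= s <= x by move: sD; rewrite inE /D /= in_itv.
  rewrite -Rintegral_itv0B// -RintegralZl//; last first.
    apply: integrableS gi => //.
    by apply: subset_itvr; rewrite bnd_simp; case/andP: sx.
  rewrite [RHS]Rintegral_mkcond; apply: eq_Rintegral => t _.
  rewrite !patchE sD !mem_setE /D !in_itv /=; case/andP: sx => s0 sx.
  case: (leP s t) => [st|ts]; last by rewrite mulr0.
  by rewrite (le_trans s0 st) /= mulr1; case: ifP => //; rewrite mulr0.
have fD : mu.-integrable setT (EFin \o (f \_ D)).
  by rewrite -restrict_EFin; apply/(integrable_mkcond _ _).1.
have gD : mu.-integrable setT (EFin \o (g \_ D)).
  by rewrite -restrict_EFin; apply/(integrable_mkcond _ _).1.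
have mle : measurable_fun setT (fun p : measurableTypeR R * measurableTypeR R =>
    (p.1 <= p.2)%R%:R : R).
  rewrite (_ : (fun _ => _) = (fun b : bool => b%:R) \o
    (fun p : measurableTypeR R * measurableTypeR R => p.1 <= p.2))//.
  by apply: measurableT_comp => //; apply: measurable_fun_ler.
have hi : (mu \x mu)%E.-integrable setT (EFin \o h).
  have fgi := integrable_tensor _ _ fD gD.
  have mfg := measurable_int _ fgi.
  apply: le_integrable fgi => //.
    by apply/measurable_EFinP/measurable_funM; [apply/measurable_EFinP|exact: mle].
  move=> p _; rewrite lee_fin /h !normrM ler_piMr// ?mulr_ge0//.
  by rewrite ger0_norm// lern1 leq_b1.
have hFubini : \int[mu]_s \int[mu]_t h (s, t) = \int[mu]_t \int[mu]_s h (s, t).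
  have sec1 s : mu.-integrable setT (fun t => (h (s, t))%:E).
    have gs := integrableZl measurableT ((f \_ D) s) gD.
    have mh : measurable_fun setT (fun t => (h (s, t))%:E).
      exact: measurableT_comp (measurable_int _ hi) (pair1_measurable s).
    apply: le_integrable gs => //.
    move=> t _; rewrite lee_fin /h !normrM ler_piMr// ?mulr_ge0//.
    by rewrite ger0_norm// lern1 leq_b1.
  have sec2 t : mu.-integrable setT (fun s => (h (s, t))%:E).
    have gs := integrableZl measurableT ((g \_ D) t) fD.
    have mh : measurable_fun setT (fun s => (h (s, t))%:E).
      exact: measurableT_comp (measurable_int _ hi) (pair2_measurable t).
    apply: le_integrable gs => //.
    move=> s _; rewrite lee_fin /h !normrM [X in _ <= X]mulrC ler_piMr// ?mulr_ge0//.
    by rewrite ger0_norm// lern1 leq_b1.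
  transitivity (fine (\int[mu]_s \int[mu]_t (h (s, t))%:E)%E).
    congr fine; apply: eq_integral => s _.
    by rewrite /Rintegral fineK// integrable_fin_num.
  have -> := Fubini hi; congr fine; apply: eq_integral => t _.
  by rewrite /Rintegral fineK// integrable_fin_num.
have : \int[mu]_(s in D) (f s * (G x - G s)) = \int[mu]_(t in D) (g t * F t).
  rewrite Rintegral_mkcond [RHS]Rintegral_mkcond.
  transitivity (\int[mu]_s \int[mu]_t h (s, t)).
    by apply: eq_Rintegral => s _; rewrite inner_t.
  by rewrite hFubini; apply: eq_Rintegral => s _; rewrite inner_s.
clear hFubini inner_s inner_t int0 hi mle fD gD h.
have fGi := integrableM_primitive f g x x0 fi gi.
have gFi := integrableM_primitive g f x x0 gi fi.
rewrite RintegralD// => <-.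
under [X in _ + X]eq_Rintegral do rewrite mulrBr.
rewrite RintegralB//; last first.
  by rewrite (_ : _ \o _ = (fun t => (G x)%:E * (f t)%:E)%E); [exact: integrableZl|
    apply/funext => t; rewrite /= mulrC EFinM].
by rewrite addrC subrK RintegralZr.
Qed.
End RealIntegration.

(** * Integration of complex-valued functions *)

Section Components.
Context {R : rcfType}.
Implicit Types z w : R[i].
Lemma Re_add z w : complex.Re (z + w) = complex.Re z + complex.Re w.
Proof. by case: z; case: w. Qed.
Lemma Im_add z w : complex.Im (z + w) = complex.Im z + complex.Im w.
Proof. by case: z; case: w. Qed.
Lemma Re_opp z : complex.Re (- z) = - complex.Re z. Proof. by case: z. Qed.
Lemma Im_opp z : complex.Im (- z) = - complex.Im z. Proof. by case: z. Qed.
Lemma Re_mul z w : complex.Re (z * w) =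
  complex.Re z * complex.Re w - complex.Im z * complex.Im w.
Proof. by case: z; case: w. Qed.
Lemma Im_mul z w : complex.Im (z * w) =
  complex.Re z * complex.Im w + complex.Im z * complex.Re w.
Proof. by case: z; case: w. Qed.
Lemma Re_conj z : complex.Re (conjc z) = complex.Re z. Proof. by case: z. Qed.
Lemma Im_conj z : complex.Im (conjc z) = - complex.Im z. Proof. by case: z. Qed.
Lemma Re_norm_sqr z :
  complex.Re `|z| ^+ 2 = complex.Re z ^+ 2 + complex.Im z ^+ 2.
Proof. by rewrite normc_def /= sqr_sqrtr // addr_ge0 // sqr_ge0. Qed.
Lemma complexP z w :
  complex.Re z = complex.Re w -> complex.Im z = complex.Im w -> z = w.
Proof. by case: z => a b; case: w => c d /= -> ->. Qed.
End Components.

Definition compE {R : rcfType} :=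
  (@Re_add R, @Im_add R, @Re_opp R, @Im_opp R, @Re_mul R, @Im_mul R,
   @Re_conj R, @Im_conj R).

Section ComplexIntegral.
Local Open Scope classical_set_scope.
Context {R : realType}.
Local Notation mu := (@lebesgue_measure R).
Local Notation I01 := (`[0, 1]%classic : set R).
Implicit Types (D : set (measurableTypeR R)) (f g : R -> R[i]) (c : R[i]).

(** Componentwise integrability, matching the componentwise integral. *)
Definition cintegrable D f :=
  mu.-integrable D (EFin \o (fun x => complex.Re (f x))) /\
  mu.-integrable D (EFin \o (fun x => complex.Im (f x))).

Lemma integrable_lin D (a b : R) (u v : R -> R) : measurable D ->
  mu.-integrable D (EFin \o u) -> mu.-integrable D (EFin \o v) ->
  mu.-integrable D (EFin \o (fun x => a * u x + b * v x)).
Proof.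
move=> mD ui vi.
have -> : EFin \o (fun x => a * u x + b * v x) =
    ((fun x => a%:E * (u x)%:E) \+ (fun x => b%:E * (v x)%:E))%E.
  by apply/funext => x.
by apply: integrableD => //; apply: integrableZl.
Qed.

Lemma cintegrableZ D c f : measurable D ->
  cintegrable D f -> cintegrable D (fun x => c * f x).
Proof.
move=> mD [f1 f2]; split.
  have := integrable_lin D (complex.Re c) (- complex.Im c) _ _ mD f1 f2.
  by congr (_.-integrable _ _); apply/funext => x /=; rewrite !compE mulNr.
have := integrable_lin D (complex.Re c) (complex.Im c) _ _ mD f2 f1.
by congr (_.-integrable _ _); apply/funext => x /=; rewrite !compE.
Qed.

Lemma eq_cintegral D f g : {in D, f =1 g} -> cintegral D f = cintegral D g.
Proof.
by move=> fg; rewrite /cintegral; congr Complex; apply: eq_Rintegral => x xD;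
  rewrite fg.
Qed.

Lemma Rintegral_lin D (a b : R) (u v : R -> R) : measurable D ->
  mu.-integrable D (EFin \o u) -> mu.-integrable D (EFin \o v) ->
  \int[mu]_(x in D) (a * u x + b * v x) =
  a * \int[mu]_(x in D) u x + b * \int[mu]_(x in D) v x.
Proof.
move=> mD ui vi; rewrite RintegralD//; first by rewrite !RintegralZl.
  have := integrable_lin D a 0 _ _ mD ui ui.
  by congr (_.-integrable _ _); apply/funext => x /=; rewrite mul0r addr0.
have := integrable_lin D b 0 _ _ mD vi vi.
by congr (_.-integrable _ _); apply/funext => x /=; rewrite mul0r addr0.
Qed.

Lemma cintegralD D f g : measurable D -> cintegrable D f -> cintegrable D g ->
  cintegral D (fun x => f x + g x) = cintegral D f + cintegral D g.
Proof.
move=> mD [f1 f2] [g1 g2]; apply: complexP; rewrite !compE /=.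
  under eq_Rintegral do rewrite Re_add.
  by rewrite RintegralD.
under eq_Rintegral do rewrite Im_add.
by rewrite RintegralD.
Qed.

Lemma cintegralZ D c f : measurable D -> cintegrable D f ->
  cintegral D (fun x => c * f x) = c * cintegral D f.
Proof.
move=> mD [f1 f2]; apply: complexP; rewrite !compE /=.
  under eq_Rintegral do rewrite Re_mul -mulNr.
  by rewrite Rintegral_lin// mulNr.
under eq_Rintegral do rewrite Im_mul.
by rewrite Rintegral_lin.
Qed.

Lemma cintegralN D f : measurable D -> cintegrable D f ->
  cintegral D (fun x => - f x) = - cintegral D f.
Proof.
by move=> mD fi; rewrite -mulN1r -cintegralZ//; apply: eq_cintegral => x _;
  rewrite mulN1r.
Qed.

Lemma cintegral_conj D f : measurable D -> cintegrable D f ->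
  cintegral D (fun x => conjc (f x)) = conjc (cintegral D f).
Proof.
move=> mD [f1 f2]; apply: complexP; rewrite compE /=.
  by under eq_Rintegral do rewrite Re_conj.
under eq_Rintegral do rewrite Im_conj -mulN1r.
by rewrite RintegralZl// mulN1r.
Qed.

Lemma ae_eq_cintegral D f g : measurable D ->
  cintegrable D f -> cintegrable D g -> ae_eq mu D f g ->
  cintegral D f = cintegral D g.
Proof.
move=> mD [f1 f2] [g1 g2] fg; rewrite /cintegral /Rintegral; congr Complex; congr fine.
  apply: ae_eq_integral => //; [exact: measurable_int f1|exact: measurable_int g1|].
  by apply: filterS fg => x fg Dx /=; rewrite fg.
apply: ae_eq_integral => //; [exact: measurable_int f2|exact: measurable_int g2|].
by apply: filterS fg => x fg Dx /=; rewrite fg.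
Qed.

Lemma cintegrable_itv0S f (t x : R) : t <= x ->
  cintegrable `[0, x] f -> cintegrable `[0, t] f.
Proof. by move=> tx [f1 f2]; split; apply: integrable_itv0S tx _. Qed.

Lemma cintegral_itv0B f (s x : R) : 0 <= s <= x -> cintegrable `[0, x] f ->
  cintegral `[s, x] f = cintegral `[0, x] f - cintegral `[0, s] f.
Proof.
by move=> sx [f1 f2]; apply: complexP; rewrite !compE /= Rintegral_itv0B.
Qed.

Lemma cintegral_itv00 f : cintegral `[0, 0] f = 0.
Proof. by apply: complexP; rewrite /= set_itv1 Rintegral_set1. Qed.

End ComplexIntegral.

(** * Square-integrable functions and the bilinear pairing *)

Section SquareIntegrable.
Local Open Scope classical_set_scope.
Context {R : realType}.
Local Notation mu := (@lebesgue_measure R).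
Local Notation I01 := (`[0, 1]%classic : set R).
Implicit Types (u v : R -> R) (f g : R -> R[i]) (c : R[i]).

(** The real counterpart of L2: by L2P, a complex function is in L2 exactly when
both its components satisfy this condition. *)
Definition rL2 u := measurable_fun I01 u /\
  mu.-integrable I01 (EFin \o (fun x => u x ^+ 2)).

(** By 2 |u v| <= u^2 + v^2. *)
Lemma rL2_integrableM u v : rL2 u -> rL2 v ->
  mu.-integrable I01 (EFin \o (fun x => u x * v x)).
Proof.
move=> [mu_ u2] [mv v2].
have uv2 := integrable_lin `[0, 1] 1 1 _ _ (measurable_itv _) u2 v2.
apply: le_integrable uv2 => //.
  by apply/measurable_EFinP; exact: measurable_funM.
move=> x _; rewrite lee_fin normrM !mul1r [leRHS]ger0_norm ?addr_ge0 ?sqr_ge0//.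
rewrite -(real_normK (num_real (u x))) -(real_normK (num_real (v x))).
set a := `|u x|; set b := `|v x|.
have := sqr_ge0 (a - b); rewrite sqrrB; nra.
Qed.

Lemma rL2_lin (a b : R) u v : rL2 u -> rL2 v -> rL2 (fun x => a * u x + b * v x).
Proof.
move=> Lu Lv; have [mu_ u2] := Lu; have [mv v2] := Lv; split.
  by apply: measurable_funD; apply: measurable_funM.
have uv := rL2_integrableM _ _ Lu Lv.
have := integrable_lin `[0, 1] 1 (2 * a * b) _ _ (measurable_itv _)
  (integrable_lin `[0, 1] (a ^+ 2) (b ^+ 2) _ _ (measurable_itv _) u2 v2) uv.
by congr (_.-integrable _ _); apply/funext => x /=; congr EFin; ring.
Qed.

Lemma rL2_bounded u : measurable_fun I01 u -> [bounded u x | x in I01] -> rL2 u.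
Proof.
move=> mu_ [M [Mr bM]]; split => //.
apply: measurable_bounded_integrable => //.
- exact/compact_finite_measure/segment_compact.
- exact: measurable_funM.
exists ((`|M| + 1) ^+ 2); split; first exact: num_real.
move=> N hN x x01; rewrite /= normrX; apply: ltW; apply: le_lt_trans hN.
by rewrite lerXn2r ?nnegrE ?addr_ge0// bM// ltr_pwDr// ler_norm.
Qed.

Lemma rL2_cst (a : R) : rL2 (fun=> a).
Proof.
apply: rL2_bounded; first exact: measurable_cst.
by exists `|a|; split; [exact: num_real|move=> N /ltW aN x _].
Qed.

Lemma rL2_integrable u : rL2 u -> mu.-integrable I01 (EFin \o u).
Proof.
move=> Lu; have := rL2_integrableM u (fun=> 1) Lu (rL2_cst 1).
by congr (_.-integrable _ _); apply/funext => x /=; rewrite mulr1.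
Qed.

Lemma L2P f : L2 f <->
  rL2 (fun x => complex.Re (f x)) /\ rL2 (fun x => complex.Im (f x)).
Proof.
split=> [[m1 m2 f2]|[[m1 f1] [m2 f2]]]; last first.
  split=> //; have := integrable_lin `[0, 1] 1 1 _ _ (measurable_itv _) f1 f2.
  by congr (_.-integrable _ _); apply/funext => x /=; rewrite Re_norm_sqr !mul1r.
split; split => //.
  apply: le_integrable f2 => //.
    by apply/measurable_EFinP; exact: measurable_funM.
  move=> x _; rewrite lee_fin Re_norm_sqr !ger0_norm ?addr_ge0 ?sqr_ge0//.
  by rewrite lerDl sqr_ge0.
apply: le_integrable f2 => //.
  by apply/measurable_EFinP; exact: measurable_funM.
move=> x _; rewrite lee_fin Re_norm_sqr !ger0_norm ?addr_ge0 ?sqr_ge0//.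
by rewrite lerDr sqr_ge0.
Qed.

Lemma L2_cintegrable f : L2 f -> cintegrable I01 f.
Proof. by move/L2P => [f1 f2]; split; exact: rL2_integrable. Qed.

Lemma L2_cintegrableM f g : L2 f -> L2 g -> cintegrable I01 (fun x => f x * g x).
Proof.
move=> /L2P[f1 f2] /L2P[g1 g2]; split.
  have := integrable_lin `[0, 1] 1 (-1) _ _ (measurable_itv _)
    (rL2_integrableM _ _ f1 g1) (rL2_integrableM _ _ f2 g2).
  by congr (_.-integrable _ _); apply/funext => x /=; rewrite Re_mul mul1r mulN1r.
have := integrable_lin `[0, 1] 1 1 _ _ (measurable_itv _)
  (rL2_integrableM _ _ f1 g2) (rL2_integrableM _ _ f2 g1).
by congr (_.-integrable _ _); apply/funext => x /=; rewrite Im_mul !mul1r.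
Qed.

Lemma L2_lin c f g : L2 f -> L2 g -> L2 (fun x => c * f x + g x).
Proof.
move=> /L2P[f1 f2] /L2P[g1 g2]; apply/L2P; split.
  have := rL2_lin 1 1 _ _ (rL2_lin (complex.Re c) (- complex.Im c) _ _ f1 f2) g1.
  by congr rL2; apply/funext => x; rewrite !compE !mul1r mulNr.
have := rL2_lin 1 1 _ _ (rL2_lin (complex.Re c) (complex.Im c) _ _ f2 f1) g2.
by congr rL2; apply/funext => x; rewrite !compE !mul1r.
Qed.

Lemma L2_conj f : L2 f -> L2 (fun x => conjc (f x)).
Proof.
move=> /L2P[f1 f2]; apply/L2P; split.
  by move: f1; congr rL2; apply/funext => x; rewrite Re_conj.
have := rL2_lin (-1) 0 _ _ f2 f2.
by congr rL2; apply/funext => x; rewrite Im_conj mul0r addr0 mulN1r.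
Qed.

Lemma L2_cst c : L2 (fun=> c).
Proof. by apply/L2P; split; exact: rL2_cst. Qed.

Lemma L2_sum (I : Type) (s : seq I) (c : I -> R[i]) (h : I -> R -> R[i]) :
  (forall i, L2 (h i)) -> L2 (fun x => \sum_(i <- s) c i * h i x).
Proof.
move=> Lh; elim: s => [|i s IH].
  by have := L2_cst 0; congr L2; apply/funext => x; rewrite big_nil.
have := L2_lin (c i) _ _ (Lh i) IH.
by congr L2; apply/funext => x; rewrite big_cons.
Qed.

Lemma pairingC f g : pairing f g = pairing g f.
Proof. by apply: eq_cintegral => x _; rewrite mulrC. Qed.

Lemma pairing_lin c f g h : L2 f -> L2 g -> L2 h ->
  pairing (fun x => c * f x + g x) h = c * pairing f h + pairing g h.
Proof.
move=> Lf Lg Lh; have fh := L2_cintegrableM _ _ Lf Lh.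
have gh := L2_cintegrableM _ _ Lg Lh.
rewrite /pairing -cintegralZ// -cintegralD//; last exact: cintegrableZ.
by apply: eq_cintegral => x _; rewrite mulrDl mulrA.
Qed.

Lemma pairing0 (h : R -> R[i]) : pairing (fun=> 0) h = 0.
Proof.
have int0 : \int[mu]_(x in I01) (0 : R) = 0 by rewrite /Rintegral integral0.
by apply: complexP; rewrite /= -[RHS]int0; apply: eq_Rintegral => x _; rewrite mul0r.
Qed.

Lemma pairing_sum (I : Type) (s : seq I) (c : I -> R[i]) (h : I -> R -> R[i]) g :
  (forall i, L2 (h i)) -> L2 g ->
  pairing (fun x => \sum_(i <- s) c i * h i x) g = \sum_(i <- s) c i * pairing (h i) g.
Proof.
move=> Lh Lg; elim: s => [|i s IH].
  rewrite big_nil; transitivity (pairing (fun=> 0) g); last exact: pairing0.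
  by apply: eq_cintegral => x _; rewrite big_nil.
rewrite [RHS]big_cons -IH -pairing_lin//; last exact: L2_sum.
by apply: eq_cintegral => x _; rewrite big_cons.
Qed.

Lemma pairing_ae f f' g : L2 f -> L2 f' -> L2 g -> eqL2 f f' ->
  pairing f g = pairing f' g.
Proof.
move=> Lf Lf' Lg ff'; apply: ae_eq_cintegral => //; try exact: L2_cintegrableM.
by apply: filterS ff' => x ff' x01; rewrite ff'.
Qed.

End SquareIntegrable.

(** * Absolutely continuous functions and Green's identity *)

Section Primitives.
Local Open Scope classical_set_scope.
Context {R : realType}.
Local Notation mu := (@lebesgue_measure R).
Local Notation I01 := (`[0, 1]%classic : set R).
Implicit Types (u v : R -> R) (F G f g : R -> R[i]) (c : R[i]).

(** The real counterpart of is_primitive, for one component. *)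
Definition real_primitive (U u : R -> R) :=
  mu.-integrable I01 (EFin \o u) /\
  forall x : R, 0 <= x <= 1 -> U x = U 0 + \int[mu]_(t in `[0, x]) u t.

Lemma is_primitiveP F f : is_primitive F f <->
  real_primitive (fun x => complex.Re (F x)) (fun x => complex.Re (f x)) /\
  real_primitive (fun x => complex.Im (F x)) (fun x => complex.Im (f x)).
Proof.
split=> [[f1 f2 hF]|[[f1 h1] [f2 h2]]]; last first.
  split; [exact: f1|exact: f2|move=> x x01; apply: complexP; rewrite compE /=].
    exact: h1.
  exact: h2.
split; split; [exact: f1| |exact: f2|] => x /hF ->; by rewrite compE.
Qed.

Lemma real_primitive_rL2 (U u : R -> R) : real_primitive U u -> rL2 U.
Proof.
move=> [ui hU]; have [mI [M [Mr bM]]] := measurable_primitive u 1 ler01 ui.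
have UE : {in I01, (fun x => U 0 + \int[mu]_(t in `[0, x]) u t) =1 U}.
  by move=> x; rewrite inE /= in_itv /= => /hU ->.
apply: rL2_bounded.
  apply: eq_measurable_fun UE _; apply: measurable_funD => //.
exists (`|U 0| + (`|M| + 1)); split; first exact: num_real.
move=> N hN x x01; rewrite /= -UE ?inE//; apply: ltW; apply: le_lt_trans hN.
by rewrite (le_trans (ler_normD _ _))// lerD2l bM// ltr_pwDr// ler_norm.
Qed.

Lemma is_primitive_L2 F f : is_primitive F f -> L2 F.
Proof.
by move=> /is_primitiveP[h1 h2]; apply/L2P; split;
  [exact: real_primitive_rL2 h1|exact: real_primitive_rL2 h2].
Qed.

Lemma integrableM_real_primitive (v U u : R -> R) : real_primitive U u ->
  mu.-integrable I01 (EFin \o v) -> mu.-integrable I01 (EFin \o (fun x => v x * U x)).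
Proof.
move=> [ui hU] vi.
have := integrable_lin `[0, 1] (U 0) 1 _ _ (measurable_itv _) vi
  (integrableM_primitive v u 1 ler01 vi ui).
apply: eq_integrable => // x; rewrite inE /= in_itv /= => /hU ->.
by rewrite mul1r mulrDr mulrC.
Qed.

Lemma real_primitiveM (U u V v : R -> R) :
  real_primitive U u -> real_primitive V v ->
  real_primitive (fun x => U x * V x) (fun x => u x * V x + v x * U x).
Proof.
move=> hU hV; have [ui Ux] := hU; have [vi Vx] := hV.
have uVi := integrableM_real_primitive u V v hV ui.
have vUi := integrableM_real_primitive v U u hU vi.
split.
  have := integrable_lin `[0, 1] 1 1 _ _ (measurable_itv _) uVi vUi.
  by apply: eq_integrable => // x _ /=; rewrite !mul1r.
move=> x x01; have /andP[x0 x1] := x01.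
have uxi := integrable_itv0S _ _ _ x1 ui.
have vxi := integrable_itv0S _ _ _ x1 vi.
have uVxi := integrableM_primitive u v x x0 uxi vxi.
have vUxi := integrableM_primitive v u x x0 vxi uxi.
have E : {in (`[0, x] : set R), (fun t => u t * V t + v t * U t) =1
  (fun t => 1 * (V 0 * u t + U 0 * v t) +
     1 * (u t * \int[mu]_(s in `[0, t]) v s + v t * \int[mu]_(s in `[0, t]) u s))}.
  move=> t; rewrite inE /= in_itv /= => /andP[t0 tx].
  have t01 : 0 <= t <= 1 by rewrite t0 (le_trans tx).
  rewrite (Ux t t01) (Vx t t01).
  by move: (\int[mu]_(s in _) u s) (\int[mu]_(s in _) v s) => a b; ring.
under eq_Rintegral => t tx do rewrite (E t tx).
rewrite Rintegral_lin//; last 2 first.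
- exact: integrable_lin.
- have := integrable_lin `[0, x] 1 1 _ _ (measurable_itv _) uVxi vUxi.
  by apply: eq_integrable => // t _ /=; rewrite !mul1r.
rewrite Rintegral_by_parts// Rintegral_lin// (Ux x x01) (Vx x x01).
by move: (\int[mu]_(s in _) u s) (\int[mu]_(s in _) v s) => a b; ring.
Qed.

Lemma real_primitive_lin (a b : R) (U u V v : R -> R) :
  real_primitive U u -> real_primitive V v ->
  real_primitive (fun x => a * U x + b * V x) (fun x => a * u x + b * v x).
Proof.
move=> [ui Ux] [vi Vx]; split; first exact: integrable_lin.
move=> x x01; have /andP[x0 x1] := x01.
have uxi := integrable_itv0S _ _ _ x1 ui.
have vxi := integrable_itv0S _ _ _ x1 vi.
rewrite (Ux x x01) (Vx x x01) Rintegral_lin//.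
by move: (\int[mu]_(s in _) u s) (\int[mu]_(s in _) v s) => r s; ring.
Qed.

Lemma is_primitive_lin c F f G g : is_primitive F f -> is_primitive G g ->
  is_primitive (fun x => c * F x + G x) (fun x => c * f x + g x).
Proof.
move=> /is_primitiveP[F1 F2] /is_primitiveP[G1 G2]; apply/is_primitiveP; split.
  have := real_primitive_lin 1 1 _ _ _ _
    (real_primitive_lin (complex.Re c) (- complex.Im c) _ _ _ _ F1 F2) G1.
  by congr real_primitive; apply/funext => x; rewrite !compE !mul1r mulNr.
have := real_primitive_lin 1 1 _ _ _ _
  (real_primitive_lin (complex.Re c) (complex.Im c) _ _ _ _ F2 F1) G2.
by congr real_primitive; apply/funext => x; rewrite !compE !mul1r.
Qed.

Lemma is_primitiveM F f G g : is_primitive F f -> is_primitive G g ->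
  is_primitive (fun x => F x * G x) (fun x => f x * G x + g x * F x).
Proof.
move=> /is_primitiveP[F1 F2] /is_primitiveP[G1 G2]; apply/is_primitiveP; split.
  have := real_primitive_lin 1 (-1) _ _ _ _
    (real_primitiveM _ _ _ _ F1 G1) (real_primitiveM _ _ _ _ F2 G2).
  by congr real_primitive; apply/funext => x; rewrite !compE; ring.
have := real_primitive_lin 1 1 _ _ _ _
  (real_primitiveM _ _ _ _ F1 G2) (real_primitiveM _ _ _ _ F2 G1).
by congr real_primitive; apply/funext => x; rewrite !compE; ring.
Qed.

Lemma is_primitive_conj F f : is_primitive F f ->
  is_primitive (fun x => conjc (F x)) (fun x => conjc (f x)).
Proof.
move=> /is_primitiveP[F1 F2]; apply/is_primitiveP; split.
  by move: F1; congr real_primitive; apply/funext => x; rewrite compE.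
have := real_primitive_lin (-1) 0 _ _ _ _ F2 F2.
by congr real_primitive; apply/funext => x; rewrite !compE; ring.
Qed.

Lemma eq_is_primitive F F' f f' : {in I01, F =1 F'} -> f =1 f' ->
  is_primitive F f -> is_primitive F' f'.
Proof.
move=> FF' /funext <- [f1 f2 hF]; split; [exact: f1|exact: f2|move=> x x01].
have E0 : F 0 = F' 0 by apply: FF'; rewrite inE /= in_itv /= lexx ler01.
have Ex : F x = F' x by apply: FF'; rewrite inE /= in_itv /=.
by rewrite -E0 -Ex; exact: hF.
Qed.

Lemma is_primitive_cst c : is_primitive (fun=> c) (fun=> 0).
Proof.
split; try by apply: integrable0.
move=> x _; have -> : cintegral `[0, x] (fun=> 0 : R[i]) = 0; last by rewrite addr0.
by apply: complexP; rewrite /= /Rintegral integral0.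
Qed.

Lemma is_primitiveZ c F f :
  is_primitive F f -> is_primitive (fun x => c * F x) (fun x => c * f x).
Proof.
move=> hF; apply: eq_is_primitive (is_primitive_lin c _ _ _ _ hF (is_primitive_cst 0)).
  by move=> x _; rewrite addr0.
by move=> x; rewrite addr0.
Qed.

Lemma is_primitiveD F f G g : is_primitive F f -> is_primitive G g ->
  is_primitive (fun x => F x + G x) (fun x => f x + g x).
Proof.
move=> hF hG; apply: eq_is_primitive (is_primitive_lin 1 _ _ _ _ hF hG).
  by move=> x _; rewrite mul1r.
by move=> x; rewrite mul1r.
Qed.

Lemma is_primitive_cintegral f : cintegrable I01 f ->
  is_primitive (fun x => cintegral `[0, x] f) f.
Proof. by move=> [f1 f2]; split=> [||x _]; [exact: f1|exact: f2|rewrite cintegral_itv00 add0r]. Qed.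

Lemma is_primitive_cintegrable F f : is_primitive F f -> cintegrable I01 f.
Proof. by case. Qed.

Lemma is_primitive_itv F f (x : R) : is_primitive F f -> 0 <= x <= 1 ->
  cintegral `[0, x] f = F x - F 0.
Proof. by move=> [_ _ hF] /hF ->; rewrite addrC addKr. Qed.

(** An absolutely continuous function is determined, up to its value at 0, by the
almost everywhere class of its derivative. *)
Lemma is_primitive_ae F G f g (x : R) : is_primitive F f -> is_primitive G g ->
  eqL2 f g -> 0 <= x <= 1 -> F x - F 0 = G x - G 0.
Proof.
move=> hF hG fg x01; have /andP[x0 x1] := x01.
rewrite -(is_primitive_itv _ _ _ hF)// -(is_primitive_itv _ _ _ hG)//.
apply: ae_eq_cintegral => //.
- exact: cintegrable_itv0S x1 (is_primitive_cintegrable _ _ hF).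
- exact: cintegrable_itv0S x1 (is_primitive_cintegrable _ _ hG).
by apply: ae_eq_subset fg; apply: subset_itvl; rewrite bnd_simp.
Qed.

Lemma is_primitive_id : is_primitive (fun x : R => x%:C%C) (fun=> 1).
Proof.
apply/is_primitiveP; split => /=; last first.
  by have /is_primitiveP[] := is_primitive_cst 0.
split.
  exact: (rL2_integrable _ (rL2_cst 1)).
move=> x /andP[x0 _].
rewrite Rintegral_cst// mul1r add0r. 
have E := @lebesgue_measure_itv R `[0, x]%R; rewrite /= lte_fin in E.
rewrite [X in fine X]E.
by move: x0; rewrite le_eqVlt => /orP[/eqP<-|->]; rewrite ?ltxx//= subr0.
Qed.

Lemma is_primitive_horner (p : {poly R[i]}) :
  is_primitive (fun x : R => p.[x%:C%C]) (fun x => (deriv p).[x%:C%C]).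
Proof.
elim/poly_ind: p => [|p c IH].
  by apply: eq_is_primitive (is_primitive_cst 0) => [x _|x]; rewrite ?deriv0 horner0.
apply: eq_is_primitive (is_primitiveD _ _ _ _
  (is_primitiveM _ _ _ _ IH is_primitive_id) (is_primitive_cst c)).
  by move=> x _; rewrite hornerMXaddC.
by move=> x; rewrite derivMXaddC hornerD hornerMX addr0 mul1r addrC.
Qed.

Lemma L2_horner (p : {poly R[i]}) : L2 (fun x : R => p.[x%:C%C]).
Proof. exact: is_primitive_L2 (is_primitive_horner p). Qed.

Lemma poly_antiderivative (p : {poly R[i]}) :
  exists2 q : {poly R[i]}, deriv q = p & (size q <= (size p).+1)%N.
Proof.
exists (\poly_(j < (size p).+1) (p`_j.-1 / j%:R)); last exact: size_poly.
apply/polyP => j; rewrite coef_deriv coef_poly ltnS /=.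
case: ltnP => [_|pj]; last by rewrite nth_default// mul0rn.
by rewrite -[LHS]mulr_natr divfK// pnatr_eq0.
Qed.

(** The formal antiderivative of p and F have the same derivative almost
everywhere, so they differ by a constant. *)
Lemma is_primitive_poly F f (p : {poly R[i]}) : is_primitive F f ->
  eqL2 f (fun x => p.[x%:C%C]) ->
  exists2 q : {poly R[i]}, (size q <= (size p).+1)%N &
    forall x : R, 0 <= x <= 1 -> F x = q.[x%:C%C].
Proof.
move=> hF fp; have [q qp sq] := poly_antiderivative p.
have hq := is_primitive_horner q; rewrite qp in hq.
exists (q + (F 0 - q.[0])%:P).
  rewrite (leq_trans (size_polyD _ _))// geq_max sq.
  by rewrite (leq_trans (size_polyC_leq1 _)).
move=> x x01; have := is_primitive_ae _ _ _ _ _ hF hq fp x01.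
by rewrite hornerD hornerC => /eqP; rewrite subr_eq => /eqP ->; rewrite rmorph0; ring.
Qed.

(** The function du v - u dv has derivative u z - w v, because the products of
first derivatives cancel. *)
Lemma green_identity (u du w v dv z : R -> R[i]) :
  is_primitive u du -> is_primitive du (fun x => - w x) ->
  is_primitive v dv -> is_primitive dv (fun x => - z x) ->
  L2 w -> L2 z ->
  pairing u z - pairing w v =
  du 1 * v 1 - dv 1 * u 1 - (du 0 * v 0 - dv 0 * u 0).
Proof.
move=> hu hdu hv hdv Lw Lz.
have hD := is_primitive_lin (-1) _ _ _ _
  (is_primitiveM _ _ _ _ hdv hu) (is_primitiveM _ _ _ _ hdu hv).
have := is_primitive_itv _ _ 1 hD; rewrite lexx ler01 => /(_ isT) E.
transitivity (cintegral I01 (fun x => u x * z x + (-1) * (w x * v x))).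
  have uz := L2_cintegrableM _ _ (is_primitive_L2 _ _ hu) Lz.
  have wv := L2_cintegrableM _ _ Lw (is_primitive_L2 _ _ hv).
  by rewrite cintegralD ?cintegralZ ?mulN1r//; exact: cintegrableZ.
transitivity (cintegral I01 (fun x => -1 * (- z x * u x + du x * dv x) +
    (- w x * v x + dv x * du x))); last by rewrite E; ring.
by apply: eq_cintegral => x _; ring.
Qed.

(** Splitting the integral at x, |x - y| is x - y below and y - x above, and each
part is integrated by parts; F1 and F2 are the first two iterated primitives of
f. *)
Lemma opK_itv (f : R -> R[i]) (x : R) : cintegrable I01 f -> 0 <= x <= 1 ->
  let F1 := fun t => cintegral `[0, t] f in
  let F2 := fun t => cintegral `[0, t] F1 in
  opK f x = - F2 x + 2^-1 * (F1 1 * (x - 1)%:C%C + F2 1).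
Proof.
move=> fi x01 F1 F2; have /andP[x0 x1] := x01.
have hF1 : is_primitive F1 f by exact: is_primitive_cintegral.
have F1i := L2_cintegrable _ (is_primitive_L2 _ _ hF1).
have hF2 : is_primitive F2 F1 by exact: is_primitive_cintegral.
have hG : is_primitive (fun y : R => (y - x)%:C%C) (fun=> 1).
  apply: eq_is_primitive (is_primitiveD _ _ _ _ is_primitive_id
    (is_primitive_cst (- x%:C%C))) => y; last by rewrite addr0.
  by move=> _; rewrite rmorphB.
pose k (y : R) := (y - x)%:C%C * f y.
have hk : is_primitive (fun y => F1 y * (y - x)%:C%C - F2 y) k.
  apply: eq_is_primitive (is_primitive_lin (-1) _ _ _ _ hF2
    (is_primitiveM _ _ _ _ hF1 hG)) => [y _|y]; first by ring.
  by rewrite /k; ring.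
have kx (y : R) : 0 <= y <= 1 -> cintegral `[0, y] k = F1 y * (y - x)%:C%C - F2 y.
  move=> y01; rewrite (is_primitive_itv _ _ _ hk y01) /F1 /F2 !cintegral_itv00.
  by ring.
pose h (y : R) := (`|x - y|)%:C%C * f y.
have ki : cintegrable I01 k := is_primitive_cintegrable _ _ hk.
have hE1 : {in (`[0, x] : set R), h =1 (fun y => - k y)}.
  move=> y; rewrite inE /= in_itv /= => /andP[_ yx].
  by rewrite /h /k ger0_norm ?subr_ge0// -mulNr -rmorphN opprB.
have hE2 : {in (`[x, 1] : set R), h =1 k}.
  move=> y; rewrite inE /= in_itv /= => /andP[xy _].
  by rewrite /h /k ler0_norm ?subr_le0// opprB.
have hi : cintegrable I01 h.
  have Labs : L2 (fun y : R => (`|x - y|)%:C%C).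
    apply/L2P; split=> /=; last exact: rL2_cst.
    apply: rL2_bounded.
      by apply: measurableT_comp => //; apply: measurable_funB.
    exists 1; split; [exact: num_real|move=> N N1 y].
    rewrite /= in_itv /= => /andP[y0 y1]; rewrite normr_id ler_norml; lra.
  have [h1 h2] := ki.
  have mk : measurable_fun I01 (fun y => complex.Re (f y)) /\
            measurable_fun I01 (fun y => complex.Im (f y)).
    by have [f1 f2] := fi; split; apply/measurable_EFinP;
      [exact: measurable_int f1|exact: measurable_int f2].
  have [mk1 mk2] := mk.
  have mabs : measurable_fun I01 (fun y : R => `|x - y|).
    by apply: measurableT_comp => //; apply: measurable_funB.
  split; [apply: le_integrable h1 => //|apply: le_integrable h2 => //].
  - apply/measurable_EFinP; rewrite (_ : (fun _ => _) =
      (fun y => `|x - y| * complex.Re (f y))); first exact: measurable_funM.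
    by apply/funext => y; rewrite /h compE /= mul0r subr0.
  - by move=> y _; rewrite lee_fin /h /k !compE /= !mul0r !subr0 !normrM normr_id distrC.
  - apply/measurable_EFinP; rewrite (_ : (fun _ => _) =
      (fun y => `|x - y| * complex.Im (f y))); first exact: measurable_funM.
    by apply/funext => y; rewrite /h compE /= mul0r addr0.
  - by move=> y _; rewrite lee_fin /h /k !compE /= !mul0r !addr0 !normrM normr_id distrC.
have key : cintegral I01 h = cintegral I01 k - 2 * cintegral `[0, x] k.
  have := cintegral_itv0B _ _ _ x01 hi; have := cintegral_itv0B _ _ _ x01 ki.
  rewrite (eq_cintegral _ _ _ hE2) (eq_cintegral _ _ _ hE1) => ->.
  rewrite cintegralN ?opprK//; last exact: cintegrable_itv0S x1 ki.
  by move=> /eqP; rewrite -subr_eq => /eqP <-; ring.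
rewrite /opK -/(h) key !kx// ?lexx ?ler01//.
have -> : ((1 - x)%:C = - (x - 1)%:C)%C by rewrite -rmorphN opprB.
rewrite subrr rmorph0.
by move: (F1 1) (F1 x) (F2 1) (F2 x) => a b c d; field.
Qed.

End Primitives.

(** * The operator K *)

Section NewtonKernel.
Local Open Scope classical_set_scope.
Context {R : realType}.
Local Notation mu := (@lebesgue_measure R).
Local Notation I01 := (`[0, 1]%classic : set R).
Implicit Types (f g : R -> R[i]).

(** The function K f solves - u'' = f, with boundary values that depend only on
F1 and F2, the values at 1 of the first two iterated primitives of f. *)
Lemma opK_primitive f : L2 f -> exists F1 F2 : R[i], exists dk : R -> R[i],
  [/\ is_primitive (opK f) dk, is_primitive dk (fun x => - f x),
      opK f 0 = 2^-1 * (F2 - F1) /\ opK f 1 = - (2^-1 * F2) &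
      dk 0 = 2^-1 * F1 /\ dk 1 = - (2^-1 * F1)].
Proof.
move=> Lf; have fi := L2_cintegrable _ Lf.
pose F1 := fun t => cintegral `[0, t] f.
pose F2 := fun t => cintegral `[0, t] F1.
have hF1 : is_primitive F1 f by exact: is_primitive_cintegral.
have hF2 : is_primitive F2 F1.
  exact/is_primitive_cintegral/L2_cintegrable/(is_primitive_L2 _ _ hF1).
have opKE (x : R) : 0 <= x <= 1 ->
    opK f x = - F2 x + 2^-1 * (F1 1 * (x - 1)%:C%C + F2 1).
  by move=> x01; rewrite opK_itv.
have F10 : F1 0 = 0 by exact: cintegral_itv00.
have F20 : F2 0 = 0 by exact: cintegral_itv00.
exists (F1 1), (F2 1), (fun x => - F1 x + 2^-1 * F1 1); split.
- apply: eq_is_primitive (is_primitiveD _ _ _ _ (is_primitiveZ (-1) _ _ hF2)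
    (is_primitive_lin (2^-1 * F1 1) _ _ _ _ is_primitive_id
       (is_primitive_cst (2^-1 * (F2 1 - F1 1))))) => x.
    rewrite inE /= in_itv /= => x01; rewrite opKE// rmorphB rmorph1.
    by move: (F1 1) (F2 1) (F2 x) => a b c; ring.
  by move: (F1 1) (F1 x) => a b; ring.
- apply: eq_is_primitive (is_primitiveD _ _ _ _ (is_primitiveZ (-1) _ _ hF1)
    (is_primitive_cst (2^-1 * F1 1))) => x; last by ring.
  by move=> _; rewrite mulN1r.
- split; rewrite opKE ?lexx ?ler01//.
    rewrite F20 sub0r rmorphN rmorph1.
    by move: (F1 1) (F2 1) => a b; ring.
  rewrite subrr rmorph0.
  by move: (F1 1) (F2 1) => a b; field.
- split; first by rewrite F10; ring.
  by move: (F1 1) => a; field.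
Qed.

Lemma opK_L2 f : L2 f -> L2 (opK f).
Proof. by move=> /opK_primitive[_ [_ [dk [hk _ _ _]]]]; exact: is_primitive_L2 hk. Qed.

(** With the boundary values of opK_primitive, the boundary term of Green's
identity is zero. *)
Lemma opK_symmetric f g : L2 f -> L2 g -> pairing (opK f) g = pairing f (opK g).
Proof.
move=> Lf Lg.
have [F1 [F2 [df [hf hdf [f0 f1] [df0 df1]]]]] := opK_primitive _ Lf.
have [G1 [G2 [dg [hg hdg [g0 g1] [dg0 dg1]]]]] := opK_primitive _ Lg.
apply/eqP; rewrite -subr_eq0 (green_identity _ _ _ _ _ _ hf hdf hg hdg)//.
by rewrite f0 f1 g0 g1 df0 df1 dg0 dg1; apply/eqP; field.
Qed.

Lemma Im_cintegral f D : (forall x, complex.Im (f x) = 0) ->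
  complex.Im (cintegral D f) = 0.
Proof.
move=> f0; rewrite /cintegral /=.
have int0 : \int[mu]_(x in D) (0 : R) = 0 by rewrite /Rintegral integral0.
by rewrite -[RHS]int0; apply: eq_Rintegral => x _; rewrite f0.
Qed.

Lemma Im_opK f : (forall x, complex.Im (f x) = 0) ->
  forall x, complex.Im (opK f x) = 0.
Proof.
move=> f0 x; rewrite /opK.
have -> : (- 2^-1 : R[i]) = (- 2^-1 : R)%:C%C by rewrite rmorphN fmorphV rmorph_nat.
rewrite Im_mul Im_cintegral => [/=|y]; first by rewrite mulr0 mul0r addr0.
by rewrite Im_mul /= f0 mulr0 mul0r addr0.
Qed.

Lemma Im_pairing f g : (forall x, complex.Im (f x) = 0) ->
  (forall x, complex.Im (g x) = 0) -> complex.Im (pairing f g) = 0.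
Proof.
by move=> f0 g0; apply: Im_cintegral => x; rewrite Im_mul f0 g0 mulr0 mul0r addr0.
Qed.

End NewtonKernel.

(** * The Green's operator *)

Section GreenOperator.
Local Open Scope classical_set_scope.
Context {R : realType}.
Variables alpha beta delta : R.
Local Notation A := (gsarc alpha beta delta).
Implicit Types (f g u v w z : R -> R[i]).

(** The coefficients alpha, beta, delta are real. *)
Lemma gsarc_conj u w : A u w -> A (fun x => conjc (u x)) (fun x => conjc (w x)).
Proof.
move=> [Lu Lw [u0 [du [uu0 hu hdu b0 b1]]]]; split; [exact: L2_conj|exact: L2_conj|].
exists (fun x => conjc (u0 x)), (fun x => conjc (du x)); split.
- by apply: filterS uu0 => x uu0 x01; rewrite uu0.
- exact: is_primitive_conj.
- by apply: eq_is_primitive (is_primitive_conj _ _ hdu) => // x; rewrite rmorphN.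
- by rewrite b0; apply: complexP; rewrite !compE /=; ring.
- by rewrite b1; apply: complexP; rewrite !compE /=; ring.
Qed.

(** The boundary conditions annihilate the boundary term of Green's identity. *)
Lemma gsarc_symmetric u w v z : A u w -> A v z -> pairing u z = pairing w v.
Proof.
move=> [Lu Lw [u0 [du [uu0 hu hdu bu0 bu1]]]] [Lv Lz [v0 [dv [vv0 hv hdv bv0 bv1]]]].
rewrite (pairing_ae u u0 z Lu (is_primitive_L2 _ _ hu) Lz uu0).
rewrite (pairingC w) (pairing_ae v v0 w Lv (is_primitive_L2 _ _ hv) Lw vv0).
rewrite (pairingC v0); apply/eqP; rewrite -subr_eq0.
rewrite (green_identity _ _ _ _ _ _ hu hdu hv hdv)// bu0 bu1 bv0 bv1.
by apply/eqP; ring.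
Qed.

Lemma L2inner_conj f g : L2inner f (fun x => conjc (g x)) = pairing f g.
Proof.
apply: eq_cintegral => x _; congr (_ * _).
(* the generic conjugation of a closed field unfolds to conjc on R[i] *)
exact: conjcK.
Qed.

Variables P KG : (R -> R[i]) -> R -> R[i].
Hypothesis hP : orthogonal_projection_onto (in_kernel A) P.
Hypothesis hKG : is_green_operator A P KG.

Lemma in_kernel_conj h : in_kernel A h -> in_kernel A (fun x => conjc (h x)).
Proof.
move=> /gsarc_conj; rewrite /in_kernel.
by congr gsarc; apply/funext => x; rewrite rmorph0.
Qed.

Lemma KG_L2 f : L2 f -> L2 (KG f).
Proof. by move=> Lf; have [[]] := (hKG.2 f Lf). Qed.

Lemma KG_gsarc f : L2 f -> A (KG f) (fun x => f x - P f x).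
Proof. by move=> Lf; have [] := hKG.2 f Lf. Qed.

(** P S = 0 says that S f is orthogonal to the kernel for the Hermitian product;
as the kernel is stable under conjugation, the same holds for the pairing. *)
Lemma KG_orthogonal_kernel f h : L2 f -> in_kernel A h -> pairing (KG f) h = 0.
Proof.
move=> Lf kh; have [_ _ PK0] := hKG.2 f Lf; have LK := KG_L2 _ Lf.
have [LPK _ orth] := hP _ LK.
have [Lh _ _] := kh.
have := orth _ (in_kernel_conj _ kh); rewrite L2inner_conj => <-.
apply: pairing_ae => //.
  have := L2_lin (-1) _ _ LPK LK.
  by congr L2; apply/funext => x; rewrite mulN1r addrC.
by apply: filterS PK0 => x PK0 x01; rewrite PK0// subr0.
Qed.

Lemma pairingB_kernel w f : L2 w -> L2 f ->
  (forall h, in_kernel A h -> pairing w h = 0) ->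
  pairing (fun x => f x - P f x) w = pairing f w.
Proof.
move=> Lw Lf orth; have [LP kP _] := hP _ Lf.
transitivity (pairing (fun x => -1 * P f x + f x) w).
  by apply: eq_cintegral => x _; rewrite mulN1r [_ + f x]addrC.
by rewrite pairing_lin// (pairingC (P f)) orth// mulr0 add0r.
Qed.

Lemma KG_symmetric f g : L2 f -> L2 g -> pairing (KG f) g = pairing f (KG g).
Proof.
move=> Lf Lg; have := gsarc_symmetric _ _ _ _ (KG_gsarc _ Lf) (KG_gsarc _ Lg).
rewrite pairingC !pairingB_kernel//; try exact: KG_L2.
- by rewrite pairingC.
- by move=> h; exact: KG_orthogonal_kernel.
- by move=> h; exact: KG_orthogonal_kernel.
Qed.

Lemma pairing_conj f g : L2 f -> L2 g ->
  pairing (fun x => conjc (f x)) (fun x => conjc (g x)) = conjc (pairing f g).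
Proof.
move=> Lf Lg; rewrite -cintegral_conj//; last exact: L2_cintegrableM.
by apply: eq_cintegral => x _; rewrite rmorphM.
Qed.

Lemma conj_real f : (forall x, complex.Im (f x) = 0) -> (fun x => conjc (f x)) = f.
Proof.
by move=> f0; apply/funext => x; apply: complexP; rewrite compE ?f0 ?oppr0.
Qed.

(** The conjugate of S g is again a solution of the boundary value problem, with
the conjugate right-hand side, so gsarc_symmetric applies to it. *)
Lemma KG_conj f g : L2 f -> L2 g ->
  pairing (KG f) (fun x => conjc (g x)) = pairing f (fun x => conjc (KG g x)).
Proof.
move=> Lf Lg; have LKf := KG_L2 _ Lf; have LKg := KG_L2 _ Lg.
have := gsarc_symmetric _ _ _ _ (KG_gsarc _ Lf) (gsarc_conj _ _ (KG_gsarc _ Lg)).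
rewrite pairingB_kernel//; last 2 first.
- exact: L2_conj.
- move=> h kh; have [Lh _ _] := kh.
  rewrite (_ : pairing _ h = conjc (pairing (KG g) (fun x => conjc (h x)))).
    by rewrite KG_orthogonal_kernel ?conjc0//; exact: in_kernel_conj.
  rewrite -pairing_conj//; last exact: L2_conj.
  by apply: eq_cintegral => x _; rewrite conjcK.
move=> <-; have [LP kP _] := hP _ Lg.
transitivity (pairing (fun x => -1 * conjc (P g x) + conjc (g x)) (KG f)).
  rewrite pairing_lin//; try exact: L2_conj.
  rewrite (pairingC _ (KG f)) (KG_orthogonal_kernel _ _ Lf (in_kernel_conj _ kP)).
  by rewrite mulr0 add0r pairingC.
rewrite pairingC; apply: eq_cintegral => x _.
by rewrite rmorphB mulN1r [_ + conjc (g x)]addrC.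
Qed.

(** KG_symmetric and KG_conj together say that the pairing equals its conjugate. *)
Lemma KG_pairing_real f g : L2 f -> L2 g ->
  (forall x, complex.Im (f x) = 0) -> (forall x, complex.Im (g x) = 0) ->
  complex.Im (pairing (KG f) g) = 0.
Proof.
move=> Lf Lg f0 g0; have LK := KG_L2 _ Lf.
have : conjc (pairing (KG f) g) = pairing (KG f) g.
  rewrite -pairing_conj// (conj_real g)// pairingC -KG_conj// (conj_real f)//.
  by rewrite KG_symmetric// pairingC.
by case: (pairing _ _) => a b /= -[] /eqP; rewrite eqNr => /eqP.
Qed.

(** The projection P f has second derivative 0, so it is affine; K f - S f has
second derivative - P f, and two more integrations give a cubic. *)
Lemma opKB_KG_polynomial f : L2 f ->
  exists2 p : {poly R[i]}, (size p <= 4)%N &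
    eqL2 (fun x => opK f x - KG f x) (fun x => p.[x%:C%C]).
Proof.
move=> Lf; have [LP [_ _ [p0 [dp [Pp0 hp hdp _ _]]]] _] := hP _ Lf.
have [_ _ [v0 [dv [Kv0 hv hdv _ _]]]] := KG_gsarc _ Lf.
have [_ [_ [dk [hk hdk _ _]]]] := opK_primitive _ Lf.
have ae_I01 (F G : R -> R[i]) : (forall x : R, 0 <= x <= 1 -> F x = G x) -> eqL2 F G.
  by move=> FG; apply: aeW => x /=; rewrite in_itv /= => /FG.
have [p1 s1 dpE] : exists2 p : {poly R[i]}, (size p <= 1)%N &
    forall x : R, 0 <= x <= 1 -> dp x = p.[x%:C%C].
  have [|q sq qE] := is_primitive_poly _ _ 0 hdp.
    by apply: ae_I01 => x _; rewrite horner0 oppr0.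
  by exists q => //; rewrite size_poly0 in sq.
have [p2 s2 p0E] : exists2 p : {poly R[i]}, (size p <= 2)%N &
    forall x : R, 0 <= x <= 1 -> p0 x = p.[x%:C%C].
  have [|q sq qE] := is_primitive_poly _ _ p1 hp; first by apply: ae_I01; exact: dpE.
  by exists q => //; rewrite (leq_trans sq)// ltnS s1.
have hd1 := is_primitive_lin (-1) _ _ _ _ hdv hdk.
have hd2 := is_primitive_lin (-1) _ _ _ _ hv hk.
have [p3 s3 d1E] : exists2 p : {poly R[i]}, (size p <= 3)%N &
    forall x : R, 0 <= x <= 1 -> -1 * dv x + dk x = p.[x%:C%C].
  have [|q sq qE] := is_primitive_poly _ _ (- p2) hd1.
    apply: filterS Pp0 => x Pp0 x01; have x01' := x01.
    move: x01'; rewrite /= in_itv /= => x01'.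
    by rewrite Pp0// p0E// hornerN; ring.
  by exists q => //; rewrite (leq_trans sq)// ltnS size_polyN s2.
have [p4 s4 d2E] : exists2 p : {poly R[i]}, (size p <= 4)%N &
    forall x : R, 0 <= x <= 1 -> -1 * v0 x + opK f x = p.[x%:C%C].
  have [|q sq qE] := is_primitive_poly _ _ p3 hd2; first by apply: ae_I01; exact: d1E.
  by exists q => //; rewrite (leq_trans sq)// ltnS s3.
exists p4 => //; apply: filterS Kv0 => x Kv0 x01; rewrite Kv0//.
by move: x01; rewrite /= in_itv /= => /d2E <-; rewrite mulN1r addrC.
Qed.

End GreenOperator.

(** * Cubic polynomials and the Hilbert matrix *)

Section HilbertMatrix.
Local Open Scope classical_set_scope.
Context {R : realType}.
Local Notation toC := (real_complex R).

Implicit Types (a b : 'cV[R[i]]_4) (f g : R -> R[i]).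

(** The Gram matrix of 1, x, x^2, x^3 on [0,1], by pairing_mono. *)
Definition hilbert4 : 'M[R]_4 := \matrix_(i, j) ((i + j).+1%:R)^-1.

Lemma hilbert4_sym : hilbert4^T = hilbert4.
Proof. by apply/matrixP => i j; rewrite !mxE addnC. Qed.

(** The weights 1, 1/12, 1/180, 1/2800 are the pivots of the 4 x 4 Hilbert
matrix. *)
Lemma sum_sqr4_eq0 (x y z w : R) :
  let s := x ^+ 2 + y ^+ 2 / 12 + z ^+ 2 / 180 + w ^+ 2 / 2800 in
  0 <= s /\ (s = 0 -> [/\ x = 0, y = 0, z = 0 & w = 0]).
Proof.
have := (sqr_ge0 x, sqr_ge0 y, sqr_ge0 z, sqr_ge0 w) => -[[[x2 y2] z2] w2].
split; first by lra.
by move=> s0; split; apply/eqP; rewrite -sqrf_eq0; apply/eqP; lra.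
Qed.

(** The sum of squares in the proof is the LDL decomposition of the matrix. *)
Lemma hilbert4_pos (v : 'rV[R]_4) : v != 0 -> 0 < (v *m hilbert4 *m v^T) 0 0.
Proof.
move=> v0.
pose a := v 0 0; pose b := v 0 1; pose c := v 0 2; pose d := v 0 3.
have qE : (v *m hilbert4 *m v^T) 0 0 =
    (a + b / 2 + c / 3 + d / 4) ^+ 2 + (b + c + 9 / 10 * d) ^+ 2 / 12 +
    (c + 3 / 2 * d) ^+ 2 / 180 + d ^+ 2 / 2800.
  rewrite !mxE !big_ord_recl big_ord0 !mxE !big_ord_recl !big_ord0 !mxE /=.
  rewrite -/a.
  have -> : v 0 (lift ord0 ord0) = b by congr (v 0 _); apply: val_inj.
  have -> : v 0 (lift ord0 (lift ord0 ord0)) = c by congr (v 0 _); apply: val_inj.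
  have -> : v 0 (lift ord0 (lift ord0 (lift ord0 ord0))) = d.
    by congr (v 0 _); apply: val_inj.
  by rewrite /bump /= !addn0 !add0n; field; rewrite ?pnatr_eq0.
have [s_ge0 s_eq0] := sum_sqr4_eq0 (a + b / 2 + c / 3 + d / 4) (b + c + 9 / 10 * d)
  (c + 3 / 2 * d) d.
rewrite qE lt0r s_ge0 andbT; apply: contra_neq v0 => /s_eq0[a0 b0 c0 d0].
rewrite d0 !(mulr0, addr0) in c0 b0 *; rewrite c0 addr0 in b0.
rewrite d0 c0 b0 !mul0r !addr0 in a0.
apply/rowP => j; rewrite mxE.
case: j => [[|[|[|[|]]]] hj]//.
- by rewrite -a0 /a; congr (v 0 _); apply: val_inj.
- by rewrite -b0 /b; congr (v 0 _); apply: val_inj.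
- by rewrite -c0 /c; congr (v 0 _); apply: val_inj.
- by rewrite -d0 /d; congr (v 0 _); apply: val_inj.
Qed.

Lemma hilbert4_unit : hilbert4 \in unitmx.
Proof.
rewrite -row_free_unit; apply: inj_row_free => v vH; apply/eqP.
by apply: contraTT isT => /hilbert4_pos; rewrite vH mul0mx mxE ltxx.
Qed.

Definition mono (i : nat) (x : R) : R[i] := x%:C%C ^+ i.

Lemma cubicE a :
  cubic a = (fun x => \sum_(i < 4) a i 0 * mono i x).
Proof. by []. Qed.

Lemma mono_L2 i : L2 (mono i).
Proof.
have := L2_horner ('X^i : {poly R[i]}).
by rewrite (_ : (fun _ => _) = mono i)//; apply/funext => x; rewrite hornerXn.
Qed.

Lemma cubic_L2 a : L2 (cubic a).
Proof. by apply: L2_sum => i; exact: mono_L2. Qed.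

Lemma Im_mono i x : complex.Im (mono i x) = 0.
Proof. by rewrite /mono -rmorphXn. Qed.

Lemma pairing_mono (i j : nat) : pairing (mono i) (mono j) = ((i + j).+1%:R)^-1.
Proof.
have n0 : ((i + j).+1%:R : R[i]) != 0 by rewrite pnatr_eq0.
apply: (mulfI n0); rewrite divff//.
have hX := is_primitive_horner ('X^((i + j).+1) : {poly R[i]}).
have := is_primitive_itv _ _ 1 hX; rewrite lexx ler01 => /(_ isT).
rewrite !hornerXn rmorph1 rmorph0 expr1n expr0n subr0 => E; rewrite -[RHS]E.
rewrite -cintegralZ//; last exact: (L2_cintegrableM _ _ (mono_L2 i) (mono_L2 j)).
apply: eq_cintegral => x _.
by rewrite derivXn hornerMn hornerXn /mono -exprD mulr_natl.
Qed.

Definition moments (f : R -> R[i]) : 'rV[R[i]]_4 := \row_j pairing f (mono j).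

Lemma pairing_cubic f a : L2 f -> pairing f (cubic a) = (moments f *m a) 0 0.
Proof.
move=> Lf; rewrite pairingC pairing_sum// => [|i]; last exact: mono_L2.
by rewrite mxE; apply: eq_bigr => i _; rewrite mxE mulrC pairingC.
Qed.

Lemma moments_cubic a : moments (cubic a) = a^T *m map_mx toC hilbert4.
Proof.
apply/rowP => j; rewrite !mxE pairing_sum => [|i|]; try exact: mono_L2.
by apply: eq_bigr => i _; rewrite !mxE pairing_mono fmorphV rmorph_nat.
Qed.

Lemma moments_ae f g : L2 f -> L2 g -> eqL2 f g -> moments f = moments g.
Proof.
move=> Lf Lg fg; apply/rowP => j; rewrite !mxE.
exact: (pairing_ae f g _ Lf Lg (mono_L2 j) fg).
Qed.

End HilbertMatrix.

(** * Symmetric operators with values in the cubic polynomials *)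

Section FiniteRank.
Local Open Scope classical_set_scope.
Context {R : realType}.
Local Notation toC := (real_complex R).
Local Notation HC := (map_mx toC (@hilbert4 R)).
Implicit Types f g : R -> R[i].
Variable T : (R -> R[i]) -> R -> R[i].
Hypothesis T_L2 : forall f, L2 f -> L2 (T f).
Hypothesis T_cubic : forall f, L2 f -> exists a : 'cV[R[i]]_4, eqL2 (T f) (cubic a).
Hypothesis T_sym : forall f g, L2 f -> L2 g -> pairing (T f) g = pairing f (T g).
Hypothesis T_real : forall i j : nat, complex.Im (pairing (T (mono i)) (mono j)) = 0.

(** Let N be the matrix of pairings of T x^i with x^j, which is real and symmetric.
Expressing the moments of T f once through its coefficients and once, by
symmetry, through the moments of f shows that C = H^-1 N H^-1. *)
Lemma coef_matrix_of_moments : exists2 C : 'M[R]_4, C^T = C &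
  forall f, L2 f -> eqL2 (T f) (cubic (map_mx toC C *m (moments f)^T)).
Proof.
have /choice[tau Ttau] : forall f, exists a : 'cV[R[i]]_4, L2 f -> eqL2 (T f) (cubic a).
  move=> f; have [Lf|nLf] := pselect (L2 f); last by exists 0.
  by have [a Ta] := T_cubic _ Lf; exists a.
pose N : 'M[R]_4 := \matrix_(i, j) complex.Re (pairing (T (mono i)) (mono j)).
have NE (i j : 'I_4) : pairing (T (mono i)) (mono j) = toC (N i j).
  by rewrite mxE; apply: complexP; [by []|exact: T_real].
have Nsym : N^T = N.
  apply/matrixP => i j; apply: (@complexI R).
  rewrite mxE -!NE T_sym; try exact: mono_L2.
  by rewrite pairingC.
pose Hi := invmx (@hilbert4 R).
have HHi : hilbert4 *m Hi = 1%:M by rewrite mulmxV// hilbert4_unit.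
have HiT : Hi^T = Hi by rewrite trmx_inv hilbert4_sym.
exists (Hi *m N *m Hi); first by rewrite !trmx_mul HiT Nsym mulmxA.
move=> f Lf; have := Ttau f Lf; congr (eqL2 _ (cubic _)).
(* column i of B holds the coefficients of T applied to the i-th monomial *)
pose B : 'M[R[i]]_4 := \matrix_(i, j) tau (mono j) i 0.
have tauE g : L2 g -> (tau g)^T *m HC = moments (T g).
  move=> Lg; rewrite -moments_cubic; apply: moments_ae; first exact: cubic_L2.
    exact: T_L2.
  by apply: ae_eq_sym; exact: Ttau.
have BH : B^T *m HC = map_mx toC N.
  apply/row_matrixP => i; rewrite row_mul.
  have -> : row i B^T = (tau (mono i))^T by apply/rowP => j; rewrite !mxE.
  rewrite tauE; last exact: mono_L2.
  by apply/rowP => j; rewrite !mxE NE mxE.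
have fB : moments (T f) = moments f *m B.
  apply/rowP => j; rewrite mxE T_sym//; last exact: mono_L2.
  have Lm := @mono_L2 R j; rewrite pairingC.
  rewrite (pairing_ae _ _ _ (T_L2 _ Lm) (cubic_L2 (tau (mono j))) Lf (Ttau _ Lm)).
  rewrite pairingC pairing_cubic// !mxE; apply: eq_bigr => i _.
  by rewrite !mxE.
have HCHi : HC *m map_mx toC Hi = 1%:M by rewrite -map_mxM HHi map_mx1.
have BE : B = map_mx toC Hi *m map_mx toC N.
  have := congr1 (fun X => X *m map_mx toC Hi) BH; rewrite -mulmxA HCHi mulmx1.
  by move=> /(congr1 trmx); rewrite trmxK trmx_mul !map_trmx Nsym HiT.
apply: trmx_inj; rewrite trmx_mul trmxK map_trmx !trmx_mul HiT Nsym.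
rewrite -[LHS]mulmx1 -HCHi mulmxA tauE// fB BE !map_mxM !mulmxA.
by [].
Qed.

(** The vectors u_k are the eigenvectors e_k scaled by complex square roots of
their eigenvalues. They are orthogonal for the pairing, with squares l_k, and
independence, the range of T and the eigenvector equation all follow from this. *)
Lemma finite_rank_expansion : exists r : nat, [/\ (r <= 4)%N, has_rank T r &
    exists (M : 'M[R[i]]_4) (u : 'I_r -> 'cV[R[i]]_4) (lambda : 'I_r -> R[i]),
      [/\ is_coef_matrix T M,
          forall k, [/\ u k != 0, lambda k != 0 & M *m u k = lambda k *: u k],
          row_free (\matrix_(k < r) (u k)^T) &
          forall f : R -> R[i], L2 f ->
            eqL2 (T f)
              (fun x => \sum_(k < r) pairing f (cubic (u k)) * cubic (u k) x)]].
Proof.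
have [C Csym TC] := coef_matrix_of_moments.
have [r [l [e [r4 l0 eH CE]]]] :=
  spectral_decomposition (@hilbert4 R) hilbert4_sym hilbert4_pos 4 C Csym (rank_leq_row C).
pose s k := sqrtc (toC (l k)).
have s2 k : s k * s k = toC (l k) by rewrite -expr2 sqr_sqrtc.
pose u k : 'cV[R[i]]_4 := s k *: (map_mx toC (e k))^T.
have uT k : (u k)^T = s k *: map_mx toC (e k) by rewrite linearZ /= trmxK.
have uH j k : (u j)^T *m HC *m u k = ((j == k)%:R * toC (l k))%:M.
  rewrite uT /u -!(scalemxAl, scalemxAr) scalerA map_trmx.
  rewrite -!map_mxM eH map_scalar_mx scale_scalar_mx rmorph_nat.
  by case: eqVneq => [->|_]; rewrite ?mulr0 ?mul0r// s2 mulr1 mul1r.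
have CuE : map_mx toC C = \sum_k u k *m (u k)^T.
  rewrite CE map_mx_sum; apply: eq_bigr => k _.
  rewrite uT /u -!(scalemxAl, scalemxAr) scalerA s2.
  by rewrite map_mxZ map_mxM map_trmx.
clearbody u; clear uT.
have Tu f : L2 f ->
    eqL2 (T f) (fun x => \sum_(k < r) pairing f (cubic (u k)) * cubic (u k) x).
  move=> Lf; have := TC f Lf; congr eqL2; apply/funext => x; rewrite cubicE.
  under [RHS]eq_bigr => k _ do rewrite cubicE mulr_sumr.
  rewrite exchange_big /=; apply: eq_bigr => i _.
  under eq_bigr => k _ do rewrite mulrA.
  rewrite -mulr_suml; congr (_ * _).
  rewrite CuE mulmx_suml summxE; apply: eq_bigr => k _.
  rewrite -mulmxA -trmx_mul mulrC pairing_cubic// mxE big_ord1.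
  by congr (_ * _); rewrite mxE.
have upair j k : pairing (cubic (u j)) (cubic (u k)) = (j == k)%:R * toC (l k).
  rewrite pairing_cubic; last exact: cubic_L2.
  by rewrite moments_cubic uH mxE eqxx.
have lC0 k : toC (l k) != 0 by rewrite fmorph_eq0 l0.
have comb_pair (c : 'I_r -> R[i]) j :
    pairing (fun x => \sum_(k < r) c k * cubic (u k) x) (cubic (u j)) = c j * toC (l j).
  rewrite pairing_sum => [|k|]; try exact: cubic_L2.
  rewrite (bigD1 j isT) upair eqxx mul1r big1; first exact: addr0.
  move=> k /= kj.
  by rewrite upair (negPf kj) mul0r mulr0.
exists r; split=> //.
  exists (fun k => cubic (u k)); split.
  - by move=> k; exact: cubic_L2.
  - move=> c c0 j; apply: (mulIf (lC0 j)); rewrite mul0r -comb_pair.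
    rewrite (pairing_ae _ _ _ _ _ _ c0) ?pairing0//.
    + by apply: L2_sum => k; exact: cubic_L2.
    + exact: L2_cst.
    + exact: cubic_L2.
  move=> h Lh; split=> [[f Lf Tfh]|[c hc]].
    exists (fun k => pairing f (cubic (u k))).
    exact: ae_eq_trans (ae_eq_sym Tfh) (Tu f Lf).
  have Lc (d : 'I_r -> R[i]) : L2 (fun x => \sum_(k < r) d k * cubic (u k) x).
    by apply: L2_sum => k; exact: cubic_L2.
  exists (fun x => \sum_(k < r) (c k / toC (l k)) * cubic (u k) x) => //.
  apply: ae_eq_trans (Tu _ (Lc _)) _; apply: ae_eq_trans (ae_eq_sym hc).
  apply: aeW => x _; apply: eq_bigr => k _.
  by rewrite comb_pair divfK.
have Mu k : map_mx toC C *m HC *m u k = toC (l k) *: u k.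
  transitivity (\sum_j u j *m ((u j)^T *m HC *m u k)).
    by rewrite CuE !mulmx_suml; apply: eq_bigr => j _; rewrite !mulmxA.
  rewrite (bigD1 k isT) uH eqxx mul1r mul_mx_scalar big1; first exact: addr0.
  move=> j /= jk.
  by rewrite uH (negPf jk) mul0r mul_mx_scalar scale0r.
exists (map_mx toC C *m HC), u, (fun k => toC (l k)); split=> //.
- move=> a; have := TC _ (cubic_L2 a).
  by rewrite moments_cubic trmx_mul trmxK map_trmx hilbert4_sym mulmxA.
- move=> k; split=> //; apply: contraNneq (lC0 k) => u0.
  by have := uH k k; rewrite u0 mulmx0 eqxx mul1r => /matrixP/(_ 0 0);
    rewrite !mxE eqxx mulr1n => <-.
- apply: inj_row_free => v vU; apply/rowP => k; rewrite mxE.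
  apply: (mulIf (lC0 k)); rewrite mul0r.
  have : v *m (\matrix_(k < r) (u k)^T) *m HC *m u k = 0 by rewrite vU !mul0mx.
  rewrite (mulmx_sum_row v) 2!mulmx_suml => /matrixP/(_ 0 0).
  rewrite summxE [RHS]mxE (bigD1 k isT) big1 => [|j /= jk].
    by rewrite /= addr0 rowK -!scalemxAl uH eqxx mul1r !mxE eqxx mulr1n.
  by rewrite rowK -!scalemxAl uH (negPf jk) mul0r !mxE mul0rn mulr0.
Qed.
End FiniteRank.

(** * The GSARC problem *)

Theorem mainTheorem2 (R : realType) (alpha beta delta : R)
    (hbeta : beta != 0)
    (hDelta : delta - alpha - 2 * beta + beta ^+ 2 + alpha * delta = 0)
    (P KG : (R -> R[i]) -> (R -> R[i]))
    (hP : orthogonal_projection_onto (in_kernel (gsarc alpha beta delta)) P)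
    (hKG : is_green_operator (gsarc alpha beta delta) P KG) :
  let T : (R -> R[i]) -> (R -> R[i]) := fun f x => opK f x - KG f x in
  exists r : nat, [/\ (r <= 4)%N, has_rank T r &
    exists (M : 'M[R[i]]_4) (u : 'I_r -> 'cV[R[i]]_4) (lambda : 'I_r -> R[i]),
      [/\ is_coef_matrix T M,
          forall k, [/\ u k != 0, lambda k != 0 & M *m u k = lambda k *: u k],
          row_free (\matrix_(k < r) (u k)^T) &
          forall f : R -> R[i], L2 f ->
            eqL2 (T f)
              (fun x => \sum_(k < r) pairing f (cubic (u k)) * cubic (u k) x)]].
Proof.
move=> T.
have LK f : L2 f -> L2 (KG f) by exact: KG_L2 hKG f.
have TE f : T f = (fun x => -1 * KG f x + opK f x).
  by apply/funext => x; rewrite mulN1r addrC.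
have T_pairing f g : L2 f -> L2 g ->
    pairing (T f) g = - pairing (KG f) g + pairing (opK f) g.
  by move=> Lf Lg; rewrite TE pairing_lin ?mulN1r//; [exact: LK|exact: opK_L2].
apply: finite_rank_expansion.
- by move=> f Lf; rewrite TE; apply: L2_lin; [exact: LK|exact: opK_L2].
- move=> f Lf; have [p s4 Tp] := opKB_KG_polynomial _ _ _ _ _ hP hKG _ Lf.
  exists (\col_i p`_i); apply: ae_eq_trans Tp _; apply: aeW => x _.
  by rewrite (horner_coef_wide _ s4) cubicE; apply: eq_bigr => i _; rewrite mxE.
- move=> f g Lf Lg; rewrite T_pairing// (pairingC f) T_pairing// opK_symmetric//.
  rewrite (KG_symmetric _ _ _ _ _ hP hKG _ _ Lf Lg).
  by rewrite (pairingC (KG g)) (pairingC (opK g)).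
- move=> i j; have Li := @mono_L2 R i; have Lj := @mono_L2 R j.
  rewrite T_pairing// Im_add Im_opp.
  rewrite (KG_pairing_real _ _ _ _ _ hP hKG _ _ Li Lj); try exact: Im_mono.
  by rewrite oppr0 add0r Im_pairing; [|exact: Im_opK (Im_mono i)|exact: Im_mono].
Qed.
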